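(* Let $n\ge2$, let $\Omega\subset\mathbb{R}^n$ be a bounded convex domain, and let $0\le\alpha<2$ and $p>0$. Suppose that $u\in C(\overline\Omega)$ is a nonzero convex function satisfying $$\mu_u\ge|u|^p\operatorname{dist}(\cdot,\partial\Omega)^{-\alpha}\,d\mathcal{L}^n\quad\text{in }\Omega,\qquad u=0\quad\text{on }\partial\Omega.$$ Assume that there is a closed subset $\Gamma\subset\partial\Omega$ lying in a hyperplane and containing an $(n-1)$-dimensional ball of positive radius. Let $\Gamma'\subset\Gamma$ be a nonempty compact set in the interior of $\Gamma$. Then there exists a constant $c=c(n,p,\alpha,\Omega,\Gamma,\Gamma')>0$ such that the following holds for all $x\in\Omega$ sufficiently close to $\Gamma'$: (i) If $p-\alpha<n-2$, then $$|u(x)|\ge c\,\operatorname{dist}(x,\partial\Omega)^{\frac{2-\alpha}{n-p}}.$$ (ii) If $p-\alpha=n-2$, then $$|u(x)|\ge c\,\operatorname{dist}(x,\partial\Omega)\,\big|\log\operatorname{dist}(x,\partial\Omega)\big|^{\frac{n}{2-\alpha}}.$$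
   Context: $c(\ast,\ldots,\star)$ denotes a positive constant depending only on the quantities in the parentheses (in particular not on $u$ or $x$). $\mathcal{L}^n$ is $n$-dimensional Lebesgue measure. The interior of $\Gamma$ is understood relative to the hyperplane containing $\Gamma$. For a convex function $u$ on a convex domain $\Omega\subset\mathbb{R}^n$, the subdifferential at $x\in\Omega$ is $\partial u(x)=\{q\in\mathbb{R}^n: u(y)\ge u(x)+q\cdot(y-x)\ \text{for all }y\in\Omega\}$, and the Monge--Ampère measure of $u$ is $\mu_u(E)=|\bigcup_{x\in E}\partial u(x)|$ for Borel $E\subset\Omega$. Inequalities between measures are understood on all Borel subsets of $\Omega$. *)

(* Defs.v *)
From HB Require Import structures.
From mathcomp Require Import all_boot all_order all_algebra.
From mathcomp Require Import all_classical all_reals all_analysis.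
Import Order.TTheory GRing.Theory Num.Theory.
Import numFieldNormedType.Exports.

Set Implicit Arguments.
Unset Strict Implicit.
Unset Printing Implicit Defensive.

Local Open Scope classical_set_scope.
Local Open Scope ring_scope.

Section Euclidean.
Context {R : realType} {n : nat}.
Implicit Types (x y q a : 'rV[R]_n) (A : set 'rV[R]_n).

Definition dot x y : R := \sum_(i < n) x ord0 i * y ord0 i.

(* The library norm `|x| on 'rV[R]_n is the sup norm, hence this one. *)
Definition enorm x : R := Num.sqrt (dot x x).

(* Only meaningful for nonempty A: inf set0 = 0. *)
Definition dist x A : R := inf [set enorm (x - y) | y in A].

Definition boundary A : set 'rV[R]_n := closure A `\` interior A.

(* A hyperplane when a != 0. *)
Definition hyperplane a (b : R) : set 'rV[R]_n := [set x | dot a x = b].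

Definition relative_interior (H A : set 'rV[R]_n) : set 'rV[R]_n :=
  [set x | A x /\ exists2 r : R, 0 < r &
    forall y, H y -> enorm (y - x) < r -> A y].

Definition bounded_convex_domain A :=
  [/\ open A, A !=set0, convex_set A & bounded_set A].

End Euclidean.

Section Lebesgue.
Context {R : realType} {n : nat}.
Implicit Types (a b : 'rV[R]_n) (X : set 'rV[R]_n).
Local Open Scope ereal_scope.

Definition box (ab : 'rV[R]_n * 'rV[R]_n) : set 'rV[R]_n :=
  [set x | forall i, (ab.1 ord0 i <= x ord0 i <= ab.2 ord0 i)%R].

Definition box_volume (ab : 'rV[R]_n * 'rV[R]_n) : R :=
  (\prod_(i < n) Num.max 0 (ab.2 ord0 i - ab.1 ord0 i))%R.

(* The index set D allows finite and empty families of boxes; it only matters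
   when n = 0, where no box is empty. *)
Definition lebesgue_outer X : \bar R :=
  ereal_inf [set s | exists (D : set nat) (B : nat -> 'rV[R]_n * 'rV[R]_n),
    X `<=` \bigcup_(k in D) box (B k) /\
    s = \esum_(k in D) (box_volume (B k))%:E].

Lemma box_volume_ge0 ab : (0 <= box_volume ab)%R.
Proof. by apply: prodr_ge0 => i _; rewrite le_max lexx. Qed.

Let lebesgue_outer_ge0 X : 0 <= lebesgue_outer X.
Proof.
apply: le_ereal_inf_tmp => _ [D [B [_ ->]]].
by apply: esum_ge0 => k _; rewrite lee_fin box_volume_ge0.
Qed.

Let lebesgue_outer0 : lebesgue_outer set0 = 0.
Proof.
apply/eqP; rewrite eq_le lebesgue_outer_ge0 andbT.
apply: ereal_inf_lbound; exists set0, (fun=> (0%R, 0%R)).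
by rewrite esum_set0; split.
Qed.

Let le_lebesgue_outer : {homo lebesgue_outer : X Y / X `<=` Y >-> X <= Y}.
Proof.
move=> X Y XY; apply: ereal_inf_le_tmp => _ [D [B [YB ->]]].
by exists D, B; split => //; exact: subset_trans YB.
Qed.

Let lebesgue_outer_sigma_subadditive : sigma_subadditive lebesgue_outer.
Proof.
move=> F; have [[i ioo]|Foo] := pselect (exists i, lebesgue_outer (F i) = +oo).
  rewrite (eseries_pinfty _ _ ioo) ?leey// => k _.
  by rewrite -ltNye (lt_le_trans _ (lebesgue_outer_ge0 _)).
apply/lee_addgt0Pr => e e0.
rewrite (le_trans _ (epsilon_trick _ _ (ltW e0)))//.
have hB m : exists DB : set nat * (nat -> 'rV[R]_n * 'rV[R]_n),
    F m `<=` \bigcup_(k in DB.1) box (DB.2 k) /\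
    \esum_(k in DB.1) (box_volume (DB.2 k))%:E <=
      lebesgue_outer (F m) + (e / (2 ^ m.+1)%:R)%:E.
  have Ffin : lebesgue_outer (F m) \is a fin_num.
    rewrite ge0_fin_numE// ltey; apply/eqP => mF; apply: Foo.
    by exists m.
  have em : (0 < e / (2 ^ m.+1)%:R)%R by rewrite divr_gt0// ltr0n expn_gt0.
  have [_ [D [B [FB ->]]] lt] := lb_ereal_inf_adherent em Ffin.
  by exists (D, B); split => //; exact: ltW.
have [G hG] := choice hB.
pose J := [set mk : nat * nat | (G mk.1).1 mk.2].
pose v (mk : nat * nat) := (box_volume ((G mk.1).2 mk.2))%:E.
have v0 mk : 0 <= v mk by rewrite lee_fin box_volume_ge0.
apply: (@le_trans _ _ (\esum_(mk in J) v mk)).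
  have /card_esym/ppcard_eqP[f] := card_nat2.
  apply: ereal_inf_lbound; exists (f @^-1` J), (fun k => (G (f k).1).2 (f k).2).
  split.
    move=> x [m _ /(hG m).1 [k Dk Bx]].
    by exists (f^-1%FUN (m, k)); rewrite /= /J/= invK ?inE.
  rewrite (reindex_esum (f @^-1` J) J f)//.
  split => //.
  - by move=> i j _ _; apply: inj; rewrite inE.
  - move=> mk Jmk; exists (f^-1%FUN mk); last by rewrite invK ?inE.
    by rewrite /= invK ?inE.
rewrite (_ : J = setT `*`` (fun m => (G m).1)); last first.
  by apply/seteqP; split => [[m k]|[m k] []]//=; split.
rewrite -(esum_esum (a := fun m k => v (m, k)))//.
rewrite nneseries_esumT; last first.
  move=> m; apply: adde_ge0; first exact: lebesgue_outer_ge0.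
  by rewrite lee_fin divr_ge0// ltW.
by apply: le_esum => m _; exact: (hG m).2.
Qed.

HB.instance Definition _ := isOuterMeasure.Build R 'rV[R]_n lebesgue_outer
  lebesgue_outer0 lebesgue_outer_ge0 le_lebesgue_outer
  lebesgue_outer_sigma_subadditive.

End Lebesgue.

Notation lebesgue_space R n := (caratheodory_type (@lebesgue_outer R n)).

(* n-dimensional Lebesgue measure, on the sigma-algebra of
   Caratheodory-measurable sets (completeness matters below: the set of
   subgradients over a Borel set need not be Borel). *)
Definition leb (R : realType) (n : nat) :
    {measure set (lebesgue_space R n) -> \bar R} :=
  let mu : {outer_measure set 'rV[R]_n -> \bar R} := @lebesgue_outer R n in
  (mu : set (caratheodory_type mu) -> \bar R).

Section MongeAmpere.
Context {R : realType} {n : nat}.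
Implicit Types (Omega E : set 'rV[R]_n) (u : 'rV[R]_n -> R).
Local Open Scope ereal_scope.

Definition subdifferential Omega u (x : 'rV[R]_n) : set 'rV[R]_n :=
  [set q | forall y, Omega y -> (u x + dot q (y - x) <= u y)%R].

Definition monge_ampere Omega u E : \bar R :=
  leb R n (\bigcup_(x in E) subdifferential Omega u x).

Definition borel_set E := (<<s @open 'rV[R]_n >>) E.

(* mu_u >= f dL^n as measures on Omega *)
Definition monge_ampere_ge Omega u (f : 'rV[R]_n -> R) :=
  forall E, borel_set E -> E `<=` Omega ->
  \int[leb R n]_(x in (E : set (lebesgue_space R n))) (f x)%:E
    <= monge_ampere Omega u E.

End MongeAmpere.

(* Main.v *)
Require Import Defs.
From mathcomp Require Import all_boot all_order all_algebra.
From mathcomp Require Import all_classical all_reals all_analysis.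
From mathcomp Require Import measurable_realfun ring lra.
Import Order.TTheory GRing.Theory Num.Theory.
Import numFieldNormedType.Exports.
Local Open Scope classical_set_scope.
Local Open Scope ring_scope.

Set Implicit Arguments.
Unset Strict Implicit.
Unset Printing Implicit Defensive.

(** Write [h] for the height above the hyperplane of the flat piece and look at
    a point at small height [t] over an interior point of the piece. Since [u]
    is convex and negative, [-u] is a positive concave function; the proof
    combines this concavity with one local estimate.

    Local mass balance ([mass_le_oscillation]). Suppose that on a cylinder of
    radius [r] and height of order [t] over the piece [u] lies below a linear
    function [- M * h], and exceeds it in absolute value by at most [V] at the
    centre. By concavity it does so by at most [2 * V] on the inner half of the
    cylinder, so there the subgradients of [u + M * h] have vertical component
    at most of order [V / t] and horizontal components at most of order
    [V / r]. The gradient image has volume at most of order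
    [V ^ n / (t * r ^ (n-1))], whereas the lower bound on the Monge-Ampere
    measure gives at least [m ^ p * t ^ (- alpha) * (t * r ^ (n-1))], up to a
    constant, when [|u| >= m] there. Hence
    [m ^ p * t ^ (2 - alpha) <= C * V ^ n]
    with [C] depending on [r] and [n].

    Case (i). Take [M = 0] and [V = |u|] at the centre. By concavity [m] may be
    taken to be [V / 2], and [V ^ (n - p) >= c * t ^ (2 - alpha)] is the claim.
    The same choice gives [|u| >= c * t] in case (ii).

    Case (ii). Let [g t = |u| / t] on a vertical line. Concavity along segments
    joining the point at height [t] to the flat piece gives
    [u <= - g t * h] on a full cylinder below height [t / 2]
    ([flat_piece_below]). This cylinder has half the radius of the piece
    whatever [t] is, because the base points of the segments move in the whole
    piece, so no radius is lost when the step is repeated. The mass balance with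
    [M = g t] now bounds the excess from below by a multiple of
    [t * (g t) ^ (p / n)], that is
    [g (t / 4) >= g t + c * (g t) ^ (p / n)] ([depth_growth]).
    As [1 - p / n = (2 - alpha) / n], iterating this inequality, which is a
    discrete form of [G' = c * G ^ (p / n)] in the variable [|log t|], makes
    [g t] grow at least like [|log t| ^ (n / (2 - alpha))] ([log_growth]).

    The constants are independent of [u] because each step only uses the
    convexity of [u], its sign, and the mass lower bound. No rotation is used:
    the hyperplane is parametrised by all coordinates except one, and both the
    cylinders and the gradient images are sheared boxes. *)

(** * Open sets are measurable for the Lebesgue outer measure *)

Section MeasureTheory.
Context {R : realType} {n : nat}.
Implicit Types (x y q : 'rV[R]_n) (A X : set 'rV[R]_n).

Lemma interval_cut_length (l r c : R) :
  Num.max 0 (Num.min r c - l) + Num.max 0 (r - Num.max l c) <=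
  Num.max 0 (r - l).
Proof. by rewrite /Num.min /Num.max; do !case: ltP => ? //=; lra. Qed.

(** Cutting every box of a cover along a coordinate hyperplane yields covers of
    the two parts, and the volumes of the two pieces of a box add up. *)
Lemma halfspace_caratheodory (i : 'I_n) (c : R) :
  (@lebesgue_outer R n).-cara.-measurable [set x : 'rV[R]_n | x ord0 i <= c].
Proof.
apply: le_caratheodory_measurable => X.
apply: le_ereal_inf_tmp => _ [D [B [XB ->]]].
pose lo k : 'rV[R]_n * 'rV[R]_n := ((B k).1,
  \row_j (if j == i then Num.min ((B k).2 ord0 j) c else (B k).2 ord0 j)).
pose hi k : 'rV[R]_n * 'rV[R]_n :=
  (\row_j (if j == i then Num.max ((B k).1 ord0 j) c else (B k).1 ord0 j),
   (B k).2).
apply: (@le_trans _ _ (\esum_(k in D) (box_volume (lo k))%:E +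
                       \esum_(k in D) (box_volume (hi k))%:E)%E).
  apply: leeD; apply: ereal_inf_lbound.
  - exists D, lo; split => // x [/XB [k Dk Bx] /= xc].
    exists k => // j; have /andP[h1 h2] := Bx j.
    rewrite /lo /= mxE h1 /=; case: eqP => // ji.
    by rewrite le_min h2 ji.
  - exists D, hi; split => // x [/XB [k Dk Bx] /= /negP xc].
    exists k => // j; have /andP[h1 h2] := Bx j.
    rewrite /hi /= mxE h2 andbT; case: eqP => // ji.
    by rewrite ge_max h1 ji /= ltW// ltNge.
rewrite -esumD; try by move=> k _; rewrite lee_fin box_volume_ge0.
apply: le_esum => k _; rewrite -EFinD lee_fin /box_volume.
rewrite [X in X + _ <= _](bigD1 i)//= [X in _ + X <= _](bigD1 i)//=.
rewrite [X in _ <= X](bigD1 i)//= !mxE eqxx.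
set p1 := \prod_(j < n | _) _; set p2 := \prod_(j < n | _) _.
set p3 := \prod_(j < n | _) _.
have -> : p1 = p3 by apply: eq_bigr => j /negPf ji; rewrite !mxE ji.
have -> : p2 = p3 by apply: eq_bigr => j /negPf ji; rewrite !mxE ji.
rewrite -mulrDl; apply: ler_wpM2r; last exact: interval_cut_length.
by apply: prodr_ge0 => j _; rewrite le_max lexx.
Qed.

(** An open set is the union of the countably many half-open boxes with rational
    vertices that it contains; half-open boxes are cut out by coordinate
    half-spaces alone. *)
Lemma open_caratheodory A : open A ->
  (@lebesgue_outer R n).-cara.-measurable A.
Proof.
move=> oA.
pose Q (ab : 'rV[rat]_n * 'rV[rat]_n) : set 'rV[R]_n :=
  [set x | forall i, ratr (ab.1 ord0 i) < x ord0 i <= ratr (ab.2 ord0 i)].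
have mQ ab : measurable (Q ab : set (lebesgue_space R n)).
  rewrite (_ : Q ab = \bigcap_(i in [set: 'I_n])
      (~` [set x : 'rV[R]_n | x ord0 i <= ratr (ab.1 ord0 i)] `&`
       [set x : 'rV[R]_n | x ord0 i <= ratr (ab.2 ord0 i)])); last first.
    apply/seteqP; split => x /= Hx i => [_|].
      by have /andP[h1 h2] := Hx i; split => //; apply/negP; rewrite -ltNge.
    by have [] := Hx i I => /negP; rewrite -ltNge => -> ->.
  apply: (@fin_bigcap_measurable _ (lebesgue_space R n)).
    exact: finite_finset.
  move=> i _; apply: measurableI; first apply: measurableC;
    exact: halfspace_caratheodory.
rewrite (_ : A = \bigcup_(ab in [set: 'rV[rat]_n * 'rV[rat]_n])
    (if `[< Q ab `<=` A >] then Q ab else set0)); last first.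
  apply/seteqP; split => [x Ax|x [ab _]]; last first.
    by case: asboolP => // /(_ x).
  have /nbhs_ballP[e /= e0 xeA] : nbhs x A by exact: open_nbhs_nbhs.
  have ex1 i : exists r : rat, x ord0 i - e < ratr r < x ord0 i.
    have [|r] := @rat_in_itvoo R (x ord0 i - e) (x ord0 i); first by lra.
    by rewrite in_itv /=; exists r.
  have ex2 i : exists r : rat, x ord0 i < ratr r < x ord0 i + e.
    have [|r] := @rat_in_itvoo R (x ord0 i) (x ord0 i + e); first by lra.
    by rewrite in_itv /=; exists r.
  have [a Ha] := choice ex1; have [b Hb] := choice ex2.
  pose ab : 'rV[rat]_n * 'rV[rat]_n := (\row_i a i, \row_i b i).
  have Qx : Q ab x.
    by move=> i; rewrite !mxE; have := Ha i; have := Hb i; lra.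
  exists ab => //; case: asboolP => // -[] y Qy; apply: xeA.
  split => // i j; rewrite ord1 /ball /= ltr_norml.
  by have := Qy j; have := Ha j; have := Hb j; rewrite !mxE; lra.
apply: (@countable_bigcupT_measurable _ (lebesgue_space R n)).
  exact: countableP.
by move=> ab; case: ifP.
Qed.

(** The integral of [f] is a supremum over the simple functions below [f], and
    [m] times the indicator of [A] is one of them. *)
Lemma le_integral_cst_leb (A : set 'rV[R]_n) (f : 'rV[R]_n -> R) (m : R) :
  open A -> 0 <= m -> (forall x, A x -> m <= f x) ->
  (m%:E * leb R n A <=
    \int[leb R n]_(x in (A : set (lebesgue_space R n))) (f x)%:E)%E.
Proof.
move=> oA m0 mf.
have mA : measurable (A : set (lebesgue_space R n)) := open_caratheodory oA.
rewrite integral_mkcond ge0_integralTE; last first.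
  move=> x; rewrite /patch; case: ifPn => // /set_mem Ax.
  by rewrite lee_fin (le_trans m0)// mf.
pose h := scale_nnsfun (indic_nnsfun R mA) m0.
apply: (@le_trans _ _
  (sintegral (leb R n) (HBNNSimple.NonNegSimpleFun.sort h))).
  by rewrite sintegralrM sintegral_indic.
apply: ereal_sup_ubound; exists h => // x /=.
rewrite /patch /cst/= -[X in (_ * X)%:E]/(\1_A x : R) indicE.
case: (boolP (x \in A)) => [/set_mem/mf|_] /=.
  by rewrite mulr1 lee_fin.
by rewrite mulr0.
Qed.

End MeasureTheory.

(** * A lower bound for the volume of a set with long sections *)

Section SlabVolume.
Context {R : realType}.

Lemma le_esum_term (D : set nat) (f : nat -> \bar R) k : D k ->
  (forall j, (0 <= f j)%E) -> (f k <= \esum_(j in D) f j)%E.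
Proof.
move=> Dk f0; apply: esum_ge; exists [set k]%classic.
  by split => [|j ->].
by rewrite fsbig_set1.
Qed.

(** The one-dimensional step of the volume estimate: integrate the pointwise
    inequality over the interval from [a] to [b] and exchange sum and
    integral. *)
Lemma interval_weighted_cover (D : set nat) (w l r : nat -> R) (c a b : R) :
  (forall k, 0 <= w k) -> 0 <= c -> a <= b ->
  (forall s, a < s < b ->
    (c%:E <= \esum_(k in D) (w k * (l k <= s <= r k)%R%:R)%:E)%E) ->
  ((c * (b - a))%:E <= \esum_(k in D) (w k * Num.max 0 (r k - l k))%:E)%E.
Proof.
move=> w0 c0 ab cov.
pose mu := @lebesgue_measure R.
have lenE (a' b' : R) (c1 c2 : bool) :
    mu [set` Interval (BSide c1 a') (BSide c2 b')] = (Num.max 0 (b' - a'))%:E.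
  apply: etrans (lebesgue_measure_itv _) _.
  rewrite /= lte_fin; case: ltP => h.
    by rewrite -EFinB max_r// subr_ge0 ltW.
  by rewrite max_l// subr_le0.
pose v k := if k \in D then w k else 0.
have v0 k : 0 <= v k by rewrite /v; case: ifP.
have toser (g : nat -> R) : (forall k, 0 <= g k) ->
    (\esum_(k in D) (w k * g k)%:E = \sum_(0 <= k <oo) (v k * g k)%:E)%E.
  move=> g0; rewrite nneseries_esumT => [|k]; last by rewrite lee_fin mulr_ge0.
  rewrite esum_mkcond; apply: eq_esum => k _; rewrite /v.
  by case: ifP => //; rewrite mul0r.
have mI k : measurable ([set` `[l k, r k]] : set R) by [].
have -> : (c * (b - a))%:E = (\int[mu]_(s in `]a, b[) c%:E)%E.
  rewrite integral_cst// EFinM; congr (_ * _)%E.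
  by rewrite -(max_r (x := 0) (y := b - a)) ?subr_ge0//; exact/esym/lenE.
have len k : (\int[mu]_s (v k * \1_(`[l k, r k]) s)%:E =
    (v k * Num.max 0 (r k - l k))%:E)%E.
  under eq_integral do rewrite EFinM.
  rewrite ge0_integralZl_EFin//; last first.
    by apply/measurable_EFinP; exact: measurable_indic.
  rewrite integral_indic// setIT EFinM; congr (_ * _)%E.
  exact: lenE.
have mS : measurable_fun [set: measurableTypeR R]
    (fun s : measurableTypeR R =>
      \sum_(0 <= k <oo) (v k * \1_(`[l k, r k]) s)%:E)%E.
  apply: (@ge0_emeasurable_sum _ _ _ _ _ xpredT) => k.
    by move=> s _ _; rewrite lee_fin mulr_ge0// indicE.
  by move=> _; apply/measurable_EFinP; apply: measurable_funM => //;
    exact: measurable_indic.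
rewrite toser; last by move=> k; rewrite le_max lexx.
rewrite (eq_eseriesr (fun k _ => esym (len k))).
rewrite -integral_nneseries//; last 2 first.
- by move=> k; apply/measurable_EFinP; apply: measurable_funM => //;
    exact: measurable_indic.
- by move=> k s _; rewrite lee_fin mulr_ge0// indicE.
apply: (@le_trans _ _ (\int[mu]_(s in `]a, b[)
    \sum_(0 <= k <oo) (v k * \1_(`[l k, r k]) s)%:E)%E).
  apply: ge0_le_integral => //.
  - exact: measurable_funTS.
  - move=> s; rewrite /= in_itv/= => /cov; rewrite toser//.
    rewrite (@eq_eseriesr _ (fun k => (v k * \1_(`[l k, r k]) s)%:E)
      (fun k => (v k * (l k <= s <= r k)%R%:R)%:E))// => k _.
    by rewrite indicE mem_setE in_itv.
apply: ge0_subset_integral => // s _.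
by apply: nneseries_ge0 => k _ _; rewrite lee_fin mulr_ge0// indicE.
Qed.

Definition upd n (x : 'rV[R]_n) (i : 'I_n) (s : R) : 'rV[R]_n :=
  \row_j (if j == i then s else x ord0 j).

Lemma upd_eq n (x : 'rV[R]_n) i s : upd x i s ord0 i = s.
Proof. by rewrite mxE eqxx. Qed.

Lemma upd_neq n (x : 'rV[R]_n) i s j : j != i -> upd x i s ord0 j = x ord0 j.
Proof. by rewrite mxE => /negPf ->. Qed.

(** Given a cover of [E] by boxes, the sum of the products of the indicators of
    their sides is at least [1] on [E]. Integrating this inequality one
    coordinate at a time turns indicators into side lengths and ends with the
    sum of the volumes. The coordinate [i] comes first: this is the only one in
    which the sections of [E] may be displaced. *)
Lemma le_lebesgue_outer_sections n (i : 'I_n) (E : set 'rV[R]_n)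
    (y : 'rV[R]_n) (rho L : R) :
  0 <= rho -> 0 <= L ->
  (forall x : 'rV[R]_n,
     (forall j, j != i -> (`|x ord0 j - y ord0 j| : R) < rho) ->
     exists s0, forall s, s0 < s < s0 + L -> E (upd x i s)) ->
  ((L * (2 * rho) ^+ n.-1)%:E <= lebesgue_outer E)%E.
Proof.
move=> rho0 L0 sec; apply: le_ereal_inf_tmp => _ [D [B [EB ->]]].
pose len k j := Num.max 0 ((B k).2 ord0 j - (B k).1 ord0 j).
pose ind k (x : 'rV[R]_n) (j : 'I_n) : R :=
  ((B k).1 ord0 j <= x ord0 j <= (B k).2 ord0 j)%R%:R.
have len0 k j : 0 <= len k j by rewrite le_max lexx.
have ind0 k x j : 0 <= ind k x j by rewrite ler0n.
(* The coordinates listed in i :: s are already integrated. *)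
have step (s : seq 'I_n) : uniq s -> i \notin s -> forall x : 'rV[R]_n,
    (forall j, j \notin i :: s -> (`|x ord0 j - y ord0 j| : R) < rho) ->
    ((L * (2 * rho) ^+ size s)%:E <= \esum_(k in D)
      (\prod_(j < n) (if j \in i :: s then len k j else ind k x j))%:E)%E.
  elim: s => [|j0 s IH] /=.
    move=> _ _ x xy; rewrite expr0 -[L](mul1r L) mulr1.
    have [|s0 Es0] := sec x.
      by move=> j ji; apply: xy; rewrite inE.
    pose w k := \prod_(j < n | j != i) ind k x j.
    have w0 k : 0 <= w k by apply: prodr_ge0.
    have -> : \esum_(k in D)
        (\prod_(j < n) (if j \in [:: i] then len k j else ind k x j))%:E =
        \esum_(k in D) (w k * Num.max 0 ((B k).2 ord0 i - (B k).1 ord0 i))%:E.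
      apply: eq_esum => k _; rewrite (bigD1 i)//= inE eqxx mulrC.
      by congr (_ * _)%:E; apply: eq_bigr => j /negPf ji; rewrite inE ji.
    rewrite [X in (1 * X)%:E](_ : L = s0 + L - s0); last by lra.
    apply: interval_weighted_cover => //; first by lra.
    move=> s /Es0 /EB [k Dk Bk].
    apply: le_trans (le_esum_term Dk _); last first.
      by move=> j; rewrite lee_fin mulr_ge0.
    rewrite lee_fin; have := Bk i; rewrite upd_eq => ->; rewrite mulr1.
    rewrite /w big1// => j ji; have := Bk j.
    by rewrite upd_neq// /ind => ->.
  move=> /andP[j0s us]; rewrite inE negb_or => /andP[ij0 nis] x xy.
  pose w k := \prod_(j < n | j != j0)
    (if j \in i :: s then len k j else ind k x j).
  have w0 k : 0 <= w k by apply: prodr_ge0 => j _; case: ifP.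
  have -> : \esum_(k in D) (\prod_(j < n)
      (if j \in [:: i, j0 & s] then len k j else ind k x j))%:E =
      \esum_(k in D) (w k * Num.max 0 ((B k).2 ord0 j0 - (B k).1 ord0 j0))%:E.
    apply: eq_esum => k _; rewrite (bigD1 j0)//= !inE eqxx orbT mulrC.
    congr (_ * _)%:E; apply: eq_bigr => j /negPf jj0.
    by rewrite !inE jj0.
  rewrite exprSr mulrA.
  rewrite (_ : 2 * rho = (y ord0 j0 + rho) - (y ord0 j0 - rho)); last by lra.
  apply: interval_weighted_cover => //.
  - by rewrite mulr_ge0// exprn_ge0//; lra.
  - lra.
  move=> s1 hs1; rewrite (_ : _ - _ = 2 * rho); last by lra.
  apply: (le_trans (IH us nis (upd x j0 s1) _)).
    move=> j; rewrite inE negb_or => /andP[ji js].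
    have [->|jj0] := eqVneq j j0; last first.
      by rewrite upd_neq//; apply: xy; rewrite !inE !negb_or ji jj0.
    by rewrite upd_eq ltr_norml; lra.
  apply: le_esum => k _; rewrite lee_fin (bigD1 j0)//= mulrC.
  rewrite inE eq_sym (negPf ij0) (negPf j0s) /= /ind upd_eq.
  apply: ler_wpM2r; first by rewrite ler0n.
  apply: ler_prod => j jj0; rewrite upd_neq// lexx andbT.
  by case: ifP.
have := step (enum (predC1 i)) (enum_uniq _).
rewrite mem_enum !inE eqxx -cardE cardC1 card_ord => /(_ isT y).
move=> /(_ _)/le_trans; apply.
  by move=> j; rewrite inE mem_enum !inE; case: eqP.
apply: le_esum => k _; rewrite lee_fin /box_volume.
apply: ler_prod => j _; rewrite inE mem_enum !inE.
by case: eqP => //=; rewrite lexx len0.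
Qed.

End SlabVolume.

(** * An upper bound for the volume of a sheared box *)

Section ShearedBox.
Context {R : realType}.

(** Cut the range of [q ord0 i] into pieces so short that the shear moves the
    other coordinates by a fraction of [A] inside each piece. One piece more
    than needed is allowed, for the upper end point; it costs a factor [2]. *)
Lemma lebesgue_outer_sheared_box n (i : 'I_n) (c : 'rV[R]_n) (m A B : R) :
  0 < A -> 0 < B ->
  (lebesgue_outer [set q : 'rV[R]_n | (`|q ord0 i - m| <= B)%R /\
      forall j, j != i -> (`|q ord0 j - c ord0 j * q ord0 i| <= A)%R] <=
   (4 * B * (3 * A) ^+ n.-1)%:E)%E.
Proof.
move=> A0 B0.
pose C := \sum_(j < n) `|c ord0 j|.
have cC j : `|c ord0 j| <= C.
  by rewrite /C (bigD1 j)//= lerDl; apply: sumr_ge0 => k _.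
have C0 : 0 <= C by apply: sumr_ge0.
pose N := (Num.truncn (4 * B * C / A)).+1.
have N0 : 0 < N%:R :> R by rewrite ltr0n.
have NA : 4 * B * C < A * N%:R.
  by rewrite [ltRHS]mulrC -ltr_pdivrMr//; exact: truncnS_gt.
pose h := 2 * B / N%:R.
have h0 : 0 < h by rewrite divr_gt0// mulr_gt0.
have hN : h * N%:R = 2 * B by rewrite /h divfK// gt_eqF.
have hC : 2 * C * h <= A.
  rewrite -(ler_pM2r N0); apply: le_trans (ltW NA).
  rewrite (_ : 2 * C * h * N%:R = 2 * C * (h * N%:R)); last by ring.
  by rewrite hN; lra.
pose lo (k : nat) := m - B + k%:R * h.
pose bx (k : nat) : 'rV[R]_n * 'rV[R]_n :=
  (\row_j (if j == i then lo k else c ord0 j * lo k - (A + `|c ord0 j| * h)),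
   \row_j (if j == i then lo k + h
           else c ord0 j * lo k + (A + `|c ord0 j| * h))).
apply: (@le_trans _ _ (\esum_(k in `I_N.+1) (box_volume (bx k))%:E)%E).
  apply: ereal_inf_lbound; exists (`I_N.+1), bx; split => // q [qi qj].
  have q0 : 0 <= (q ord0 i - m + B) / h.
    by rewrite divr_ge0 ?(ltW h0)//; move: qi; rewrite ler_norml; lra.
  have /andP[k1 k2] := truncn_itv q0.
  set k := Num.truncn _ in k1 k2.
  rewrite ler_pdivlMr// in k1; rewrite ltr_pdivrMr// -natr1 mulrDl mul1r in k2.
  have qlo : lo k <= q ord0 i <= lo k + h by rewrite /lo; lra.
  exists k.
    rewrite /= ltnS -(ler_nat R) -(ler_pM2r h0) [leRHS]mulrC hN.
    by move: qi; rewrite ler_norml; lra.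
  move=> j; rewrite !mxE; case: eqVneq => [->//|ji].
  have := qj _ ji; rewrite -ler_distl.
  have cq : `|c ord0 j * (q ord0 i - lo k)| <= `|c ord0 j| * h.
    by rewrite normrM ler_wpM2l// ger0_norm; lra.
  move=> qA; rewrite (_ : _ - _ = (q ord0 j - c ord0 j * q ord0 i) +
    c ord0 j * (q ord0 i - lo k)); last by ring.
  by apply: (le_trans (ler_normD _ _)); rewrite lerD.
have vol k : box_volume (bx k) <= h * (3 * A) ^+ n.-1.
  rewrite /box_volume (bigD1 i)//= !mxE eqxx.
  rewrite (_ : lo k + h - lo k = h) ?max_r ?(ltW h0)//; last by ring.
  rewrite ler_wpM2l ?(ltW h0)//.
  have -> : (3 * A) ^+ n.-1 = \prod_(j < n | j != i) (3 * A).
    by rewrite prodr_const cardC1 card_ord.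
  apply: ler_prod => j ji; rewrite le_max lexx/= !mxE (negPf ji).
  rewrite ge_max; apply/andP; split; first by lra.
  have := cC j; rewrite -(ler_pM2r h0); lra.
rewrite esum_fset//; last by move=> k _; rewrite lee_fin box_volume_ge0.
rewrite -fsbig_ord/=.
apply: (@le_trans _ _ (\sum_(k < N.+1) (h * (3 * A) ^+ n.-1)%:E)%E).
  by apply: lee_sum => k _; rewrite lee_fin.
rewrite sumEFin lee_fin sumr_const card_ord -[_ *+ N.+1]mulr_natl mulrA.
rewrite ler_wpM2r ?exprn_ge0//; first by lra.
rewrite -natr1 mulrDl mul1r mulrC hN.
have : h * 1 <= h * N%:R by rewrite ler_wpM2l ?(ltW h0)// ler1n.
by rewrite hN; lra.
Qed.

End ShearedBox.

(** * Slabs over a hyperplane *)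

Section AffineCoordinates.
Context {R : realType} {n : nat}.
Implicit Types (a x y q : 'rV[R]_n) (k s : R).

Lemma dotDr a x y : dot a (x + y) = dot a x + dot a y.
Proof. by rewrite -big_split; apply: eq_bigr => j _; rewrite mxE mulrDr. Qed.

Lemma dotZr a k x : dot a (k *: x) = k * dot a x.
Proof. by rewrite mulr_sumr; apply: eq_bigr => j _; rewrite mxE mulrCA. Qed.

Lemma dotNr a x : dot a (- x) = - dot a x.
Proof. by rewrite -scaleN1r dotZr mulN1r. Qed.

Lemma dotBr a x y : dot a (x - y) = dot a x - dot a y.
Proof. by rewrite dotDr dotNr. Qed.

Lemma dot_delta a j : dot a (delta_mx 0 j) = a ord0 j.
Proof.
rewrite /dot (bigD1 j)//= mxE !eqxx mulr1 big1 ?addr0// => l lj.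
by rewrite mxE (negPf lj) andbF mulr0.
Qed.

Lemma dot_continuous a : continuous (dot a).
Proof.
apply: continuous_big => [|j _ x]; first exact: add_continuous.
have /= cj := @coord_continuous R 1 n ord0 j x.
exact: (cvgM (cvg_cst _) cj).
Qed.

Lemma ler_sum_term (f : 'I_n -> R) j :
  (forall l, 0 <= f l) -> f j <= \sum_(l < n) f l.
Proof. by move=> f0; rewrite (bigD1 j)//= lerDl sumr_ge0. Qed.

(** The height above the hyperplane [dot a x = b], up to the factor
    [enorm a]. *)
Definition ell a (b : R) x : R := dot a x - b.

Lemma ell_line a b x y k :
  ell a b (x + k *: y) = ell a b x + k * dot a y.
Proof. by rewrite /ell dotDr dotZr addrAC. Qed.

Lemma ell_conv a b x y k :
  ell a b ((1 - k) *: x + k *: y) = (1 - k) * ell a b x + k * ell a b y.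
Proof. by rewrite /ell dotDr !dotZr; ring. Qed.

Lemma ell_upd a b x i s :
  ell a b (upd x i s) = ell a b (upd x i 0) + a ord0 i * s.
Proof.
rewrite /ell /dot [in LHS](bigD1 i)//= [in RHS](bigD1 i)//= !upd_eq mulr0.
rewrite (eq_bigr (fun j => a ord0 j * upd x i 0 ord0 j)); first by ring.
by move=> j ji; rewrite !upd_neq.
Qed.

(** The direction along which [ell] grows at unit speed, when [a] is
    normalised by [`|a ord0 i| = 1]: only the [i]-th coordinate moves. *)
Definition vertical (i : 'I_n) a : 'rV[R]_n := a ord0 i *: delta_mx 0 i.

(** Moves the [j]-th coordinate at unit speed inside the hyperplanes of
    constant [ell], compensating with the [i]-th one. *)
Definition tangent (i : 'I_n) a j : 'rV[R]_n :=
  delta_mx 0 j - a ord0 j *: vertical i a.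

Lemma vertical_neq i a j : j != i -> vertical i a ord0 j = 0.
Proof. by move=> ji; rewrite !mxE (negPf ji) andbF mulr0. Qed.

Lemma dot_vertical q i a : dot q (vertical i a) = a ord0 i * q ord0 i.
Proof. by rewrite dotZr dot_delta. Qed.

Lemma dot_tangent q i a j :
  dot q (tangent i a j) = q ord0 j - a ord0 j * (a ord0 i * q ord0 i).
Proof. by rewrite dotBr dotZr dot_vertical dot_delta. Qed.

Lemma tangent_neq i a j l : l != i -> tangent i a j ord0 l = (l == j)%:R.
Proof.
by move=> li; rewrite !mxE (negPf li) andbF !mulr0 subr0 eqxx.
Qed.

Lemma coord_line x y k (l : 'I_n) :
  (x + k *: y) ord0 l = x ord0 l + k * y ord0 l.
Proof. by rewrite !mxE. Qed.

Lemma normr1_sqr k : `|k| = 1 -> k * k = 1.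
Proof. by move=> k1; rewrite -expr2 -real_normK ?num_real// k1 expr1n. Qed.

(** Cylinders over the hyperplane, in the coordinates formed by [ell] and by the
    [x ord0 j] with [j != i]. These are coordinates as soon as [a ord0 i] is
    nonzero, which makes a rotation of the hyperplane unnecessary. *)
Definition slab i a b y (rho t1 t2 : R) : set 'rV[R]_n :=
  [set x : 'rV[R]_n |
     (forall j, j != i -> (`|x ord0 j - y ord0 j| : R) < rho) /\
           t1 < ell a b x < t2].

Lemma open_slab i a b y rho t1 t2 : open (slab i a b y rho t1 t2).
Proof.
rewrite openE => x [xj /andP[x1 x2]]; rewrite /interior.
have cell : continuous (ell a b).
  by move=> z; exact: (cvgB (@dot_continuous a z) (cvg_cst _)).
have H1 : \forall z \near x, forall j, j != i ->
    `|(z : 'rV[R]_n) ord0 j - y ord0 j| < rho.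
  refine (@filter_forall _ _ (fun j (z : 'rV[R]_n) =>
    j != i -> `|z ord0 j - y ord0 j| < rho) _ (nbhs_filter x) _) => j.
  have [ji|ji] := boolP (j != i); last exact: nearW.
  have cj : (fun z : 'rV[R]_n => `|z ord0 j - y ord0 j|) @ x -->
      `|x ord0 j - y ord0 j|.
    have /= cj := @coord_continuous R 1 n ord0 j x.
    exact: (cvg_norm (cvgB cj (cvg_cst _))).
  by near=> z => _; near: z; have := cvgr_lt _ cj _ (xj j ji); exact.
have H2 : \forall z \near x, t1 < ell a b z by exact: cvgr_gt (cell x) _ x1.
have H3 : \forall z \near x, ell a b z < t2 by exact: cvgr_lt (cell x) _ x2.
near=> z; split; first by near: z.
by apply/andP; split; near: z.
Unshelve. all: by end_near. Qed.

Lemma le_lebesgue_outer_slab i a b y rho t1 t2 :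
  `|a ord0 i| = 1 -> 0 <= rho -> t1 <= t2 ->
  (((t2 - t1) * (2 * rho) ^+ n.-1)%:E <=
   lebesgue_outer (slab i a b y rho t1 t2))%E.
Proof.
move=> ai rho0 t12; apply: (@le_lebesgue_outer_sections _ _ i _ y) => //.
  by rewrite subr_ge0.
move=> x xj; set K := ell a b (upd x i 0).
have sj s j : j != i -> `|upd x i s ord0 j - y ord0 j| < rho.
  by move=> ji; rewrite upd_neq//; exact: xj.
have /eqP := ai; rewrite eqr_norml => /andP[/orP[]/eqP ai1 _].
- exists (t1 - K) => s st; split; first exact: sj.
  by rewrite ell_upd -/K ai1; lra.
- exists (K - t2) => s st; split; first exact: sj.
  by rewrite ell_upd -/K ai1; lra.
Qed.

End AffineCoordinates.

(** * Gradient image and mass on a slab *)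

Section GradientEstimate.
Context {R : realType} {n : nat}.
Implicit Types (a x y z q d : 'rV[R]_n) (Omega : set 'rV[R]_n)
  (u : 'rV[R]_n -> R).

Definition convex_on Omega u := forall x y k, Omega x -> Omega y ->
  0 <= k <= 1 -> u ((1 - k) *: x + k *: y) <= (1 - k) * u x + k * u y.

(** The situation of the local estimate: [u] lies below the linear function
    [- M * ell] on a slab over the flat piece, and exceeds it by at most [V]
    in absolute value at a point [z] in the middle of that slab. *)
Record below_linear i a b Omega u y (rho t M V : R) z : Prop := BelowLinear {
  bl_normal : `|a ord0 i| = 1;
  bl_convex : convex_on Omega u;
  bl_rho : 0 < rho;
  bl_t : 0 < t;
  bl_V : 0 < V;
  bl_sub : slab i a b y rho 0 t `<=` Omega;
  bl_below : forall x, slab i a b y rho 0 t x -> u x + M * ell a b x <= 0;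
  bl_center : forall j, j != i -> z ord0 j = y ord0 j;
  bl_height : ell a b z = t / 2;
  bl_value : - (u z + M * ell a b z) <= V }.

Definition inner_slab i a b y (rho t : R) :=
  slab i a b y (rho / 2) (t / 4) (3 * t / 4).

(** The reflection of [x] in [z] stays in the slab, where the convex function
    [u + M * ell] is nonpositive; its value at the midpoint [z] is at most half
    its value at [x]. *)
Lemma inner_slab_value i a b Omega u y rho t M V z x :
  below_linear i a b Omega u y rho t M V z -> inner_slab i a b y rho t x ->
  - (u x + M * ell a b x) <= 2 * V.
Proof.
move=> [ai ucvx rho0 t0 V0 subOmega below zy zt zV] [xj /andP[x1 x2]].
have sx : slab i a b y rho 0 t x.
  by split=> [j ji|]; [have := xj j ji; lra|lra].
have zh : z = (1 - 2^-1) *: x + 2^-1 *: (2 *: z - x).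
  by apply/rowP => j; rewrite !mxE; field.
have lx2 : ell a b (2 *: z - x) = t - ell a b x.
  by move: zt; rewrite /ell dotBr dotZr; lra.
have sx2 : slab i a b y rho 0 t (2 *: z - x).
  split=> [j ji|]; last by rewrite lx2; lra.
  rewrite !mxE zy// (_ : _ - _ = - (x ord0 j - y ord0 j)); last by ring.
  by rewrite normrN; have := xj j ji; lra.
have := ucvx _ _ 2^-1 (subOmega _ sx) (subOmega _ sx2).
rewrite -zh => /(_ _); have -> : 0 <= (2^-1 : R) <= 1 by lra.
move=> /(_ isT); have := below _ sx2; move: zV; rewrite lx2 zt; lra.
Qed.

(** The subgradient inequality at [x], tested at [x + s *: d] and
    [x - s *: d], where [u + M * ell] is nonpositive. *)
Lemma subgradient_le i a b Omega u y rho t M V z x q d s :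
  below_linear i a b Omega u y rho t M V z -> inner_slab i a b y rho t x ->
  subdifferential Omega u x q -> 0 < s ->
  slab i a b y rho 0 t (x + s *: d) -> slab i a b y rho 0 t (x - s *: d) ->
  `|dot q d + M * dot a d| <= 2 * V / s.
Proof.
move=> H Ex qx s0 sp sm; have := inner_slab_value H Ex.
case: H => [ai ucvx rho0 t0 V0 subOmega below zy zt zV].
have := qx _ (subOmega _ sp); have := below _ sp.
have := qx _ (subOmega _ sm); have := below _ sm.
rewrite -!scaleNr !ell_line ![_ + _ *: d - x]addrAC !subrr !add0r !dotZr.
move=> B1 B2 B3 B4 B5.
rewrite ler_pdivlMr// -[in leLHS](gtr0_norm s0) -normrM ler_norml.
by apply/andP; split; lra.
Qed.

(** Testing with the vertical direction, with room [t / 8] inside the slab,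
    bounds the [i]-th coordinate of [q + M *: a]; testing with the tangent
    directions, with room [rho / 4], bounds the others up to a shear. *)
Lemma gradient_image_subset i a b Omega u y rho t M V z :
  below_linear i a b Omega u y rho t M V z ->
  \bigcup_(x in inner_slab i a b y rho t) subdifferential Omega u x `<=`
  [set q : 'rV[R]_n | `|q ord0 i - (- (M * a ord0 i))| <= 16 * V / t /\
    forall j, j != i ->
      `|q ord0 j - (\row_l (a ord0 l * a ord0 i)) ord0 j * q ord0 i|
        <= 8 * V / rho].
Proof.
move=> BL; have [ai _ rho0 t0 _ _ _ _ _ _] := BL.
have ai2 := normr1_sqr ai.
move=> q [x Ex qx]; have [xj /andP[x1 x2]] := Ex; split.
  have av : dot a (vertical i a) = 1 by rewrite dot_vertical.
  have sv s : `|s| <= t / 8 -> slab i a b y rho 0 t (x + s *: vertical i a).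
    rewrite ler_norml => st; split=> [j ji|]; last by rewrite ell_line av; lra.
    by rewrite coord_line vertical_neq// mulr0 addr0; have := xj j ji; lra.
  have := subgradient_le BL Ex qx (d := vertical i a) (s := t / 8).
  rewrite -scaleNr dot_vertical av => H.
  have -> : `|q ord0 i - - (M * a ord0 i)| = `|a ord0 i * q ord0 i + M * 1|.
    rewrite -[LHS]mul1r -[X in X * _ = _]ai -normrM; congr `|_|.
    by rewrite mulrBr mulrN mulrCA ai2 opprK.
  rewrite (_ : _ / _ = 2 * V / (t / 8)); last by field; rewrite gt_eqF.
  by apply: H; [lra|apply: sv; rewrite ger0_norm; lra
    |apply: sv; rewrite normrN ger0_norm; lra].
move=> j ji.
have at0 : dot a (tangent i a j) = 0 by rewrite dot_tangent ai2 mulr1 subrr.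
have sv s : `|s| <= rho / 4 -> slab i a b y rho 0 t (x + s *: tangent i a j).
  move=> sr; split=> [l li|]; last by rewrite ell_line at0; lra.
  rewrite coord_line tangent_neq// addrAC.
  apply: (le_lt_trans (ler_normD _ _)).
  rewrite normrM; have := xj l li.
  have : `|s| * `|(l == j)%:R : R| <= `|s| * 1.
    by rewrite ler_wpM2l//; case: eqP; rewrite ?normr1 ?normr0.
  lra.
have := subgradient_le BL Ex qx (d := tangent i a j) (s := rho / 4).
rewrite -scaleNr dot_tangent at0 mulr0 addr0 mxE => H.
rewrite (_ : _ / _ = 2 * V / (rho / 4)); last by field; rewrite gt_eqF.
rewrite -[a ord0 j * _ * _]mulrA.
by apply: H; [lra|apply: sv; rewrite ger0_norm; lra
  |apply: sv; rewrite normrN ger0_norm; lra].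
Qed.

(** The local mass balance: both sides estimate the Monge-Ampere measure of the
    inner slab. *)
Lemma mass_le_oscillation i a b Omega u y rho t M V z (alpha p m : R)
    (E := inner_slab i a b y rho t) :
  below_linear i a b Omega u y rho t M V z ->
  0 <= alpha -> 0 <= p -> 0 <= m ->
  monge_ampere_ge Omega u
    (fun x => `|u x| `^ p * dist x (boundary Omega) `^ (- alpha)) ->
  (forall x, E x -> 0 < dist x (boundary Omega) <= ell a b x) ->
  (forall x, E x -> m <= `|u x|) ->
  m `^ p * t `^ (- alpha) * (t / 2 * rho ^+ n.-1) <=
    4 * (16 * V / t) * (3 * (8 * V / rho)) ^+ n.-1.
Proof.
move=> BL al0 p0 m0 MA dE mE.
have [ai _ rho0 t0 V0 subOmega _ _ _ _] := BL.
have oE : open E by exact: open_slab.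
have EO : E `<=` Omega.
  by move=> x [xj xt]; apply: subOmega; split=> [j ji|];
    [have := xj j ji; lra|lra].
set f := fun x => _ in MA.
pose c := m `^ p * t `^ (- alpha).
have c0 : 0 <= c by rewrite mulr_ge0 ?powR_ge0.
have cf x : E x -> c <= f x.
  move=> Ex; rewrite ler_pM ?powR_ge0//.
    by rewrite ge0_ler_powR ?nnegrE// mE.
  have /andP[d0 dl] := dE _ Ex; rewrite !powRN.
  rewrite lef_pV2 ?posrE ?powR_gt0//.
  rewrite ge0_ler_powR ?nnegrE// ?ltW//.
  by case: Ex => _; lra.
have := MA E (sub_gen_smallest oE) EO.
move/(le_trans (le_integral_cst_leb oE c0 cf)).
have : (lebesgue_outer (\bigcup_(x in E) subdifferential Omega u x) <=
    (4 * (16 * V / t) * (3 * (8 * V / rho)) ^+ n.-1)%:E)%E.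
  apply: le_trans (lebesgue_outer_sheared_box _ _ _ _ _).
  - by apply: le_outer_measure; exact: gradient_image_subset BL.
  - by rewrite divr_gt0// mulr_gt0.
  - by rewrite divr_gt0// mulr_gt0.
move=> H1 /le_trans/(_ H1).
have H2 : ((t / 2 * rho ^+ n.-1)%:E <= leb R n E)%E.
  rewrite (_ : t / 2 * rho ^+ n.-1 =
      (3 * t / 4 - t / 4) * (2 * (rho / 2)) ^+ n.-1); last first.
    by congr (_ * _ ^+ _); field.
  by apply: le_lebesgue_outer_slab => //; lra.
rewrite -lee_fin; apply: le_trans.
by rewrite EFinM; apply: lee_wpmul2l => //; rewrite lee_fin.
Qed.

End GradientEstimate.

(** * The recursion that produces the logarithm *)

Section LogarithmicGrowth.
Context {R : realType}.

Lemma exprD1_le (w : R) N : 0 <= w <= 1 ->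
  (1 + w) ^+ N <= 1 + (2 ^+ N - 1) * w.
Proof.
move=> /andP[w0 w1]; elim: N => [|N IH].
  by rewrite !expr0 subrr mul0r addr0.
have N1 : (1 : R) <= 2 ^+ N by rewrite exprn_ege1// ler1n.
have : (1 + w) ^+ N * (1 + w) <= (1 + (2 ^+ N - 1) * w) * (1 + w).
  by rewrite ler_wpM2r//; lra.
rewrite -exprSr => /le_trans; apply.
have : 0 <= (2 ^+ N - 1) * (w * (1 - w)) by rewrite !mulr_ge0//; lra.
by rewrite exprS; lra.
Qed.

(** One step of the recursion behind the logarithm: adding [c * G `^ (1 - 1/k)]
    to [G = Y `^ k] moves [Y] by a fixed amount. *)
Lemma powR_step (Y eta c k : R) N : 0 < eta <= Y -> 1 <= k <= N%:R ->
  2 ^+ N * eta <= c -> (Y + eta) `^ k <= Y `^ k + c * Y `^ (k - 1).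
Proof.
move=> /andP[e0 eY] /andP[k1 kN] ec.
have Y0 : 0 < Y by lra.
pose w := eta / Y.
have w0 : 0 <= w by rewrite divr_ge0 ?ltW.
have w1 : w <= 1 by rewrite ler_pdivrMr// mul1r.
have YE : Y + eta = Y * (1 + w) by rewrite mulrDr mulr1 /w mulrC divfK ?gt_eqF.
rewrite YE powRM//; [|lra..].
have wk : (1 + w) `^ k <= 1 + 2 ^+ N * w.
  apply: (@le_trans _ _ ((1 + w) `^ N%:R)); first by rewrite ler_powR//; lra.
  rewrite powR_mulrn; last by lra.
  have w01 : 0 <= w <= 1 by rewrite w0 w1.
  apply: le_trans (exprD1_le N w01) _.
  by rewrite mulrBl mul1r; lra.
apply: (@le_trans _ _ (Y `^ k * (1 + 2 ^+ N * w))).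
  by rewrite ler_wpM2l ?powR_ge0.
rewrite mulrDr mulr1 lerD2l.
have -> : Y `^ k = Y `^ (k - 1) * Y.
  by rewrite -{3}(powRr1 (ltW Y0)) -powRD ?subrK// (gt_eqF Y0) implybT.
have wY : w * Y = eta by rewrite divfK// gt_eqF.
have -> : Y `^ (k - 1) * Y * (2 ^+ N * w) = 2 ^+ N * (w * Y) * Y `^ (k - 1).
  by ring.
rewrite wY.
by rewrite ler_wpM2r ?powR_ge0.
Qed.

(** A bound at a fixed scale improves at every division of the scale by [4];
    [k] is such that [k * ((k - 1) / k) = k - 1], so [powR_step] applies. *)
Lemma iterate_quarter (g : R -> R) (T k c eta : R) N :
  0 < eta -> 1 <= k <= N%:R -> 2 ^+ N * eta <= c ->
  (forall s, 0 < s -> s <= T -> eta `^ k <= g s) ->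
  (forall s, 0 < s -> s <= T -> g s + c * g s `^ ((k - 1) / k) <= g (s / 4)) ->
  forall J s, 0 < s -> 4 ^+ J * s <= T -> (eta * J.+1%:R) `^ k <= g s.
Proof.
move=> e0 kN ec base step; have /andP[k1 _] := kN.
have c0 : 0 <= c by apply: le_trans ec; rewrite mulr_ge0 ?ltW// exprn_gt0.
elim=> [|J IH] s s0 sT.
  by rewrite mulr1 base//; move: sT; rewrite expr0 mul1r.
have s4 : 0 < s * 4 by lra.
have s4T : 4 ^+ J * (s * 4) <= T by move: sT; rewrite exprSr; lra.
have J1 : (1 : R) <= 4 ^+ J by rewrite exprn_ege1// ler1n.
have s4T' : s * 4 <= T by apply: le_trans s4T; rewrite ler_peMl// ltW.
have := step _ s4 s4T'; rewrite mulfK; last by rewrite pnatr_eq0.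
apply: le_trans.
have GY := IH _ s4 s4T.
rewrite -natr1 mulrDr mulr1.
set Y := eta * _ in GY *.
have eY : eta <= Y by rewrite /Y ler_pMr// ler1n.
have e0Y : 0 < eta <= Y by rewrite e0 eY.
apply: le_trans (powR_step e0Y kN ec) _.
rewrite lerD// ler_wpM2l//.
have -> : Y `^ (k - 1) = (Y `^ k) `^ ((k - 1) / k).
  by rewrite -powRrM mulrC divfK// gt_eqF; lra.
rewrite ge0_ler_powR ?nnegrE ?powR_ge0//.
  by rewrite divr_ge0; lra.
exact: le_trans (powR_ge0 _ _) GY.
Qed.

(** The number of divisions by [4] that lead from the scale [T] to [s] is of the
    order of [ln (T / s)]. *)
Lemma log_growth (T k c c0 : R) : 0 < T -> 1 <= k -> 0 < c -> 0 < c0 ->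
  exists2 eta : R, 0 < eta & forall g : R -> R,
    (forall s, 0 < s -> s <= T -> c0 <= g s) ->
    (forall s, 0 < s -> s <= T ->
       g s + c * g s `^ ((k - 1) / k) <= g (s / 4)) ->
    forall s, 0 < s -> s <= T -> (eta * ln (T / s)) `^ k <= g s.
Proof.
move=> T0 k1 cgt0 c00.
pose N := (Num.truncn k).+1.
have kN : 1 <= k <= N%:R by rewrite k1 ltW// truncnS_gt.
have N0 : 0 < 2 ^+ N :> R by rewrite exprn_gt0.
pose eta := Num.min (c / 2 ^+ N) (c0 `^ k^-1).
have e0 : 0 < eta by rewrite lt_min divr_gt0 ?powR_gt0.
have ln4 : 0 < ln (4 : R) by rewrite ln_gt0// ltr1n.
exists (eta / ln 4); first by rewrite divr_gt0.
move=> g base step s s0 sT.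
have ec : 2 ^+ N * eta <= c.
  by rewrite mulrC -ler_pdivlMr// ge_min lexx.
have eb : eta `^ k <= c0.
  have k0 : 0 < k by lra.
  have c0E : (c0 `^ k^-1) `^ k = c0.
    by rewrite -powRrM mulVf ?gt_eqF// powRr1// ltW.
  rewrite -[leRHS]c0E.
  apply: ge0_ler_powR; rewrite ?nnegrE ?powR_ge0//; try exact: ltW.
  by rewrite ge_min lexx orbT.
have Ts : 1 <= T / s by rewrite ler_pdivlMr// mul1r.
pose q := ln (T / s) / ln 4.
have q0 : 0 <= q by rewrite divr_ge0 ?(ltW ln4)// ln_ge0.
have /andP[J1 J2] := truncn_itv q0.
set J := Num.truncn q in J1 J2.
have H : 4 ^+ J * s <= T.
  rewrite -ler_pdivlMr// -ler_ln ?posrE ?exprn_gt0//; last by lra.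
  by rewrite lnXn// -[_ *+ J]mulr_natl -ler_pdivlMr.
have base' r : 0 < r -> r <= T -> eta `^ k <= g r.
  by move=> r0 rT; apply: le_trans eb _; exact: base.
apply: le_trans (iterate_quarter e0 kN ec base' step s0 H).
apply: (ge0_ler_powR (le_trans ler01 k1)); rewrite ?nnegrE.
- exact: mulr_ge0 (divr_ge0 (ltW e0) (ltW ln4)) (ln_ge0 Ts).
- exact: mulr_ge0 (ltW e0) (ler0n _ _).
by rewrite mulrAC -mulrA (ler_wpM2l (ltW e0))// ltW.
Qed.

End LogarithmicGrowth.

(** * Estimates above a flat piece of the boundary *)

Section FlatPiece.
Context {R : realType} {n : nat}.
Implicit Types (a x y z q : 'rV[R]_n) (Omega : set 'rV[R]_n)
  (u : 'rV[R]_n -> R).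

(** The constant of [mass_le_oscillation] once denominators are cleared. *)
Definition mass_constant (rho : R) : R := 128 * 24 ^+ n.-1 / (rho ^+ n.-1) ^+ 2.

Lemma mass_constant_gt0 rho : 0 < rho -> 0 < mass_constant rho.
Proof. by move=> r0; rewrite divr_gt0 ?mulr_gt0 ?exprn_gt0. Qed.

(** Everything that the estimates use about [Omega] and [u] near one point [y]
    of the flat piece. *)
Record flat_piece i a b Omega (alpha p : R) u y (rho T : R) : Prop :=
    FlatPiece {
  fp_normal : `|a ord0 i| = 1;
  fp_convex : convex_on Omega u;
  fp_neg : forall x, Omega x -> u x < 0;
  fp_rho : 0 < rho;
  fp_alpha : 0 <= alpha < 2;
  fp_p : 0 < p < n%:R;
  fp_base : ell a b y = 0;
  fp_sub : slab i a b y rho 0 T `<=` Omega;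
  fp_dist : forall x, slab i a b y rho 0 T x ->
    0 < dist x (boundary Omega) <= ell a b x;
  fp_mass : monge_ampere_ge Omega u
    (fun x => `|u x| `^ p * dist x (boundary Omega) `^ (- alpha)) }.

Definition depth u i a y (s : R) : R := - u (y + s *: vertical i a).

Lemma flat_piece_mass i a b Omega alpha p u y rho T t r M V m :
  flat_piece i a b Omega alpha p u y rho T ->
  0 < t <= T -> 0 < r <= rho -> 0 < V -> 0 <= m ->
  (forall x, slab i a b y r 0 t x -> u x + M * ell a b x <= 0) ->
  depth u i a y (t / 2) - M * (t / 2) <= V ->
  (forall x, inner_slab i a b y r t x -> m <= - u x) ->
  m `^ p * t `^ (2 - alpha) <= mass_constant r * V ^+ n.
Proof.
move=> [ai ucvx neg rho0 /andP[al0 al2] /andP[p0 _] yb sub dle MA].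
move=> /andP[t0 tT] /andP[r0 rr] V0 m0 below zV mE.
have ai2 := normr1_sqr ai.
have av : dot a (vertical i a) = 1 by rewrite dot_vertical.
have subs x : slab i a b y r 0 t x -> slab i a b y rho 0 T x.
  move=> [xj /andP[x1 x2]]; split=> [j ji|]; last by lra.
  by apply: lt_le_trans (xj j ji) rr.
have isub x : inner_slab i a b y r t x -> slab i a b y r 0 t x.
  move=> [xj /andP[x1 x2]]; split=> [j ji|]; last by lra.
  by apply: lt_le_trans (xj j ji) _; lra.
set z := y + (t / 2) *: vertical i a.
have zt : ell a b z = t / 2 by rewrite ell_line yb av; ring.
have BL : below_linear i a b Omega u y r t M V z.
  split => //; first by move=> x /subs/sub.
    by move=> j ji; rewrite coord_line vertical_neq// mulr0 addr0.
  by rewrite zt opprD.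
have := @mass_le_oscillation _ _ i a b Omega u y r t M V z alpha p m BL
  al0 (ltW p0) m0 MA (fun x Ex => dle x (subs x (isub x Ex))).
have /[swap] /[apply] : forall x, inner_slab i a b y r t x -> m <= `|u x|.
  by move=> x /mE; rewrite -normrN => /le_trans; apply; exact: ler_norm.
have -> : t `^ (2 - alpha) = t `^ (- alpha) * t ^+ 2.
  rewrite addrC powRD ?(gt_eqF t0) ?implybT// -(powR_mulrn 2)//.
  exact: ltW.
set A := m `^ p; set B := t `^ (- alpha).
have rn : 0 < r ^+ n.-1 by rewrite exprn_gt0.
have -> : V ^+ n = V * V ^+ n.-1.
  by rewrite -exprS prednK// (leq_trans _ (ltn_ord i)).
rewrite (_ : 3 * (8 * V / r) = 24 * V / r); last by field; rewrite gt_eqF.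
rewrite exprMn exprVn exprMn /mass_constant.
move: (V ^+ n.-1) (24 ^+ n.-1) => Vn Cn.
set rr' := r ^+ n.-1 in rn *.
move=> H.
have c0 : 0 < 2 * t / rr' by rewrite divr_gt0// mulr_gt0.
have := H; rewrite -(ler_pM2r c0).
congr (_ <= _); field; rewrite ?gt_eqF//.
Qed.

(** The point [x] lies on a segment from [q], at height [s], to a point of the
    hyperplane. That end point is only a boundary point, so [x] is written as
    [(1 - mu) *: w + mu *: q] with [w] in the slab and [mu] smaller than the
    ratio [lam] of the heights; convexity and [u w < 0] give
    [mu * - u q <= - u x], and [mu] may tend to [lam]. *)
Lemma flat_piece_below i a b Omega alpha p u y rho T s x :
  flat_piece i a b Omega alpha p u y rho T -> 0 < s < T ->
  slab i a b y (rho / 2) 0 (s / 2) x ->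
  u x + depth u i a y s / s * ell a b x <= 0.
Proof.
move=> [ai ucvx neg rho0 _ _ yb sub _ _] /andP[s0 sT] [xj /andP[x1 x2]].
have av : dot a (vertical i a) = 1 by rewrite dot_vertical normr1_sqr.
pose q := y + s *: vertical i a.
have qs : ell a b q = s by rewrite ell_line yb av; ring.
have qy j : j != i -> q ord0 j = y ord0 j.
  by move=> ji; rewrite coord_line vertical_neq// mulr0 addr0.
have Oq : Omega q.
  apply: sub; split=> [j ji|]; last by rewrite qs s0.
  by rewrite qy// subrr normr0.
set h := depth u i a y s; have hE : u q = - h by rewrite /h opprK.
have h0 : 0 < h by rewrite /h oppr_gt0; exact: neg.
pose lam := ell a b x / s.
have lam0 : 0 < lam by rewrite divr_gt0.
have lam2 : lam < 1 / 2 by rewrite ltr_pdivrMr//; lra.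
suff mu_le mu : 0 <= mu -> mu < lam -> mu * h <= - u x.
  rewrite (_ : _ * ell a b x = lam * h); last by rewrite /lam; ring.
  rewrite addrC -lerBrDr sub0r leNgt; apply/negP => ux.
  pose mu := (Num.max 0 (- u x / h) + lam) / 2.
  have uh : - u x / h < lam by rewrite ltr_pdivrMr.
  have mx : Num.max 0 (- u x / h) < lam by rewrite gt_max lam0.
  have m0 : 0 <= Num.max 0 (- u x / h) by rewrite le_max lexx.
  have mu1 : - u x / h < mu.
    apply: (@le_lt_trans _ _ (Num.max 0 (- u x / h))).
      by rewrite le_max lexx orbT.
    by rewrite /mu; lra.
  have := mu_le mu; rewrite ltr_pdivrMr// in mu1.
  by rewrite /mu in mu1 *; lra.
move=> mu0 mul.
have mu1 : 0 < 1 - mu by lra.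
pose w := (1 - mu)^-1 *: (x - mu *: q).
have xE : x = (1 - mu) *: w + mu *: q.
  by rewrite scalerA mulfV ?gt_eqF// scale1r subrK.
have Ow : Omega w.
  apply: sub; split=> [j ji|].
    have -> : w ord0 j - y ord0 j = (x ord0 j - y ord0 j) / (1 - mu).
      by rewrite /w mxE -scaleNr coord_line qy//; field; rewrite gt_eqF.
    rewrite normrM normfV (gtr0_norm mu1) ltr_pdivrMr//.
    have := xj j ji; have : rho * 2^-1 <= rho * (1 - mu).
      by rewrite ler_pM2l//; lra.
    by rewrite /Num.norm/=; lra.
  have -> : ell a b w = (ell a b x - mu * s) / (1 - mu).
    have := ell_conv a b w q mu; rewrite -xE qs => ->.
    by field; rewrite gt_eqF.
  have mus : mu * s < ell a b x by rewrite -ltr_pdivlMr.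
  rewrite divr_gt0//=; last by lra.
  rewrite ltr_pdivrMr//.
  have : T * 2^-1 < T * (1 - mu) by rewrite ltr_pM2l//; lra.
  have : 0 <= mu * s by rewrite mulr_ge0// ltW.
  by lra.
have := ucvx w q mu Ow Oq; rewrite -xE hE.
have : (1 - mu) * u w <= 0 by rewrite mulr_ge0_le0// ltW// neg.
have -> : 0 <= mu <= 1 by lra.
by move=> + /(_ isT); lra.
Qed.

Lemma flat_piece_depth_gt0 i a b Omega alpha p u y rho T s :
  flat_piece i a b Omega alpha p u y rho T -> 0 < s < T ->
  0 < depth u i a y s.
Proof.
move=> [ai ucvx neg rho0 _ _ yb sub _ _] /andP[s0 sT].
have av : dot a (vertical i a) = 1 by rewrite dot_vertical normr1_sqr.
rewrite oppr_gt0; apply: neg; apply: sub; split=> [j ji|].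
  by rewrite coord_line vertical_neq// mulr0 addr0 subrr normr0.
by rewrite ell_line yb av; lra.
Qed.

(** The mass balance with [M = 0], at a point [z] at height [s]: by concavity
    and positivity of [- u], its values on the inner slab are at least half the
    value at [z], so both [m] and [V] are comparable to that value. *)
Lemma depth_power_lower_bound i a b Omega alpha p u y rho T s :
  flat_piece i a b Omega alpha p u y rho T -> 0 < s -> 2 * s <= T ->
  s `^ (2 - alpha) <=
    2 `^ p * mass_constant rho * depth u i a y s `^ (n%:R - p).
Proof.
move=> FP s0 sT.
have [ai ucvx neg rho0 /andP[al0 al2] /andP[p0 pn] yb sub _ _] := FP.
set h := depth u i a y s.
have h0 : 0 < h by apply: flat_piece_depth_gt0 FP _; lra.
have av : dot a (vertical i a) = 1 by rewrite dot_vertical normr1_sqr.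
pose z := y + s *: vertical i a.
have zy j : j != i -> z ord0 j = y ord0 j.
  by move=> ji; rewrite coord_line vertical_neq// mulr0 addr0.
have zs : ell a b z = s by rewrite ell_line yb av; ring.
have hE : u z = - h by rewrite /h opprK.
have hs x : slab i a b y rho 0 (2 * s) x -> Omega x.
  by move=> [xj xt]; apply: sub; split=> //; lra.
have inner x : inner_slab i a b y rho (2 * s) x -> h / 2 <= - u x.
  move=> [xj /andP[x1 x2]].
  have Oz : Omega z.
    by apply: hs; split=> [j ji|]; rewrite ?zy ?subrr ?normr0// zs; lra.
  have Ox2 : Omega (2 *: x - z).
    apply: hs; split=> [j ji|].
      have -> : (2 *: x - z) ord0 j - y ord0 j = 2 * (x ord0 j - y ord0 j).
        by rewrite -scaleN1r coord_line zy// mxE; ring.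
      rewrite normrM ger0_norm//; have := xj j ji; lra.
    have -> : ell a b (2 *: x - z) = 2 * ell a b x - ell a b z.
      by rewrite /ell dotBr dotZr; ring.
    by rewrite zs; lra.
  have := ucvx z _ 2^-1 Oz Ox2.
  have -> : (1 - 2^-1) *: z + 2^-1 *: (2 *: x - z) = x.
    by apply/rowP => j; rewrite !mxE; field.
  have -> : 0 <= (2^-1 : R) <= 1 by lra.
  move=> /(_ isT); rewrite hE; have := neg _ Ox2; lra.
have h2 : 0 <= h / 2 by lra.
have s2T : 0 < 2 * s <= T by lra.
have rr : 0 < rho <= rho by rewrite rho0 lexx.
have := @flat_piece_mass i a b Omega alpha p u y rho T (2 * s) rho 0 h (h / 2)
  FP s2T rr h0 h2.
have -> : 2 * s / 2 = s by field.
rewrite -/h mul0r subr0 => /(_ _ (lexx _) inner).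
have below0 x : slab i a b y rho 0 (2 * s) x -> u x + 0 * ell a b x <= 0.
  by move=> /hs/neg; rewrite mul0r addr0 => /ltW.
move=> /(_ below0) H.
have K0 := mass_constant_gt0 rho0.
have hp : 0 < h `^ p by rewrite powR_gt0.
have hn : h ^+ n = h `^ p * h `^ (n%:R - p).
  by rewrite -powRD ?(gt_eqF h0) ?implybT// addrC subrK powR_mulrn// ltW.
rewrite hn powRM ?invr_ge0 ?(ltW h0)// in H.
have e : (2^-1 : R) `^ p = (2 `^ p)^-1.
  by rewrite -powRN -powR_inv1// -powRrM mulN1r.
have al' : 0 < 2 - alpha by rewrite subr_gt0.
have two : 0 < (2 : R) `^ p by rewrite powR_gt0.
have st : s `^ (2 - alpha) <= (2 * s) `^ (2 - alpha).
  have s2 : s <= 2 * s by rewrite ler_peMl ?ler1n ?(ltW s0).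
  apply: ge0_ler_powR s2; rewrite ?nnegrE ?(ltW s0)//; first exact/ltW.
  by rewrite mulr_ge0 ?(ltW s0).
rewrite e in H.
rewrite -(ler_pM2l hp) -(ler_pM2l (_ : 0 < (2 `^ p)^-1)) ?invr_gt0//.
apply: (@le_trans _ _ (h `^ p * (2 `^ p)^-1 * (2 * s) `^ (2 - alpha))).
  by rewrite mulrCA mulrA ler_wpM2l// mulr_ge0 ?ltW// invr_gt0.
apply: (le_trans H); rewrite le_eqVlt; apply/orP; left; apply/eqP.
by field; rewrite gt_eqF.
Qed.

End FlatPiece.

Section FlatPieceConsequences.
Context {R : realType} {n : nat}.
Implicit Types (a x y z q : 'rV[R]_n) (Omega : set 'rV[R]_n)
  (u : 'rV[R]_n -> R).

Lemma depth_lower_bound i a b Omega alpha p u y rho T s :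
  flat_piece i a b Omega alpha p u y rho T -> 0 < s -> 2 * s <= T ->
  (2 `^ p * @mass_constant R n rho) `^ (- (n%:R - p)^-1) *
    s `^ ((2 - alpha) / (n%:R - p)) <= depth u i a y s.
Proof.
move=> FP s0 sT; have H := depth_power_lower_bound FP s0 sT.
have [_ _ _ rho0 _ /andP[p0 pn] _ _ _ _] := FP.
have h0 : 0 < depth u i a y s by apply: flat_piece_depth_gt0 FP _; lra.
have K0 := @mass_constant_gt0 R n rho rho0.
have np : 0 < n%:R - p by lra.
move: H; set C := 2 `^ p * _; set h := depth u i a y s => H.
have C0 : 0 < C by rewrite mulr_gt0 ?powR_gt0.
rewrite powRN mulrC ler_pdivrMr ?powR_gt0//.
have -> : h = (h `^ (n%:R - p)) `^ (n%:R - p)^-1.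
  by rewrite -powRrM mulfV ?gt_eqF// powRr1// ltW.
rewrite powRrM -powRM ?powR_ge0//; last exact: ltW.
apply: ge0_ler_powR; rewrite ?nnegrE ?powR_ge0//.
- by rewrite invr_ge0 ltW.
- by rewrite mulr_ge0 ?powR_ge0// ltW.
- by rewrite mulrC.
Qed.

(** The mass balance with [M] the slope at scale [s], on the slab of height
    [s / 2] provided by [flat_piece_below]: the point at height [s / 4] is its
    centre, and the excess there is at least [V = c * s * M `^ (p / n%:R)] for
    the constant [c] that makes the opposite inequality contradictory. The
    powers of [s] cancel because [p + 2 - alpha = n]. *)
Lemma depth_growth (alpha p rho : R) :
  0 < rho -> 0 <= alpha < 2 -> 0 < p -> p - alpha = n%:R - 2 ->
  exists2 c : R, 0 < c & forall i a b Omega u y T s,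
    flat_piece i a b Omega alpha p u y rho T -> 0 < s < T ->
    depth u i a y s / s + c * (depth u i a y s / s) `^ (p / n%:R) <=
      depth u i a y (s / 4) / (s / 4).
Proof.
move=> rho0 /andP[al0 al2] p0 pal.
have n0 : 0 < n%:R :> R by lra.
have r0 : 0 < rho / 2 by lra.
pose K := @mass_constant R n (rho / 2).
have K0 : 0 < K by exact: mass_constant_gt0.
pose A : R := 8^-1 `^ p * 2^-1 `^ (2 - alpha).
have A0 : 0 < A by rewrite mulr_gt0// powR_gt0// invr_gt0.
pose c := (A / (2 * K)) `^ (n%:R)^-1.
have AK : 0 < A / (2 * K) by rewrite divr_gt0// mulr_gt0.
have c0 : 0 < c by rewrite powR_gt0.
have cn : K * c ^+ n = A / 2.
  rewrite -powR_mulrn ?ltW// -powRrM mulVf ?gt_eqF// powRr1 ?ltW//.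
  by field; rewrite gt_eqF.
exists (4 * c); first by rewrite mulr_gt0.
move=> i a b Omega u y T s FP /andP[s0 sT].
have sT' : 0 < s < T by rewrite s0.
have h0 := flat_piece_depth_gt0 FP sT'.
set M := depth u i a y s / s.
have M0 : 0 < M by rewrite divr_gt0.
rewrite ler_pdivlMr; last by lra.
rewrite leNgt; apply/negP => lt.
pose V := c * s * M `^ (p / n%:R).
have V0 : 0 < V by rewrite !mulr_gt0// powR_gt0.
have below x : slab i a b y (rho / 2) 0 (s / 2) x -> u x + M * ell a b x <= 0.
  exact: flat_piece_below FP sT'.
have inner x : inner_slab i a b y (rho / 2) (s / 2) x -> M * s / 8 <= - u x.
  move=> [xj /andP[x1 x2]].
  have := below x; have sx : slab i a b y (rho / 2) 0 (s / 2) x.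
    by split=> [j ji|]; [apply: lt_le_trans (xj j ji) _; lra|lra].
  have : M * (s / 8) <= M * ell a b x by rewrite ler_wpM2l ?ltW//; lra.
  by move=> + /(_ sx); lra.
have st : 0 < s / 2 <= T by lra.
have rr : 0 < rho / 2 <= rho by lra.
have m0 : 0 <= M * s / 8 by rewrite divr_ge0// mulr_ge0 ?ltW.
have := flat_piece_mass FP st rr V0 m0 below _ inner.
have -> : s / 2 / 2 = s / 4 by field.
have /[swap] /[apply] : depth u i a y (s / 4) - M * (s / 4) <= V.
  move: lt; rewrite mulrDl /V; set q := M `^ _ => lt.
  by rewrite lerBlDl ltW//; apply: lt_le_trans lt _; lra.
rewrite -mulrA [s / 8]mulrC -/K.
have -> : (M * (8^-1 * s)) `^ p * (s * 2^-1) `^ (2 - alpha) =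
    A * (M `^ p * s ^+ n).
  have e8 : (0 : R) <= 8^-1 by lra.
  have e2 : (0 : R) <= 2^-1 by lra.
  have s0' := ltW s0; have M0' := ltW M0.
  rewrite (powRM p M0' (mulr_ge0 e8 s0')) (powRM p e8 s0').
  rewrite (powRM (2 - alpha) s0' e2).
  rewrite -(powR_mulrn n s0').
  have -> : n%:R = p + (2 - alpha) by lra.
  by rewrite powRD ?(gt_eqF s0) ?implybT// /A; ring.
have -> : K * V ^+ n = A / 2 * (M `^ p * s ^+ n).
  rewrite /V !exprMn -(powR_mulrn n (powR_ge0 M _)) -powRrM divfK ?gt_eqF//.
  by rewrite -cn; ring.
rewrite ler_pM2r ?mulr_gt0 ?powR_gt0 ?exprn_gt0//.
by lra.
Qed.

(** [log_growth] with [k = n%:R / (2 - alpha)], for which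
    [(k - 1) / k = p / n%:R]; the bound at the first scale comes from
    [depth_lower_bound], whose exponent is [1] here. *)
Lemma depth_log_lower_bound (alpha p rho T : R) :
  (1 < n)%N -> 0 < T ->
  0 < rho -> 0 <= alpha < 2 -> 0 < p -> p - alpha = n%:R - 2 ->
  exists2 eta : R, 0 < eta & forall i a b Omega u y s,
    flat_piece i a b Omega alpha p u y rho T -> 0 < s -> 2 * s <= T ->
    (eta * ln (T / 2 / s)) `^ (n%:R / (2 - alpha)) <= depth u i a y s / s.
Proof.
move=> n1 T0 rho0 al p0 pal.
have n2 : 2 <= n%:R :> R by rewrite ler_nat.
have [c c0 step] := depth_growth rho0 al p0 pal.
have /andP[al0 al2] := al.
pose c1 := (2 `^ p * @mass_constant R n rho) `^ (- (n%:R - p)^-1).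
have c10 : 0 < c1.
  by apply/powR_gt0/mulr_gt0; [exact: powR_gt0|exact: mass_constant_gt0].
have k1 : 1 <= n%:R / (2 - alpha) by rewrite ler_pdivlMr; lra.
have T2 : 0 < T / 2 by lra.
have [eta e0 H] := log_growth T2 k1 c0 c10.
exists eta => // i a b Omega u y s FP s0 sT.
apply: (H (fun s => depth u i a y s / s)) => //; last by lra.
- move=> r r0 rT; rewrite ler_pdivlMr//.
  have rT2 : 2 * r <= T by lra.
  have := depth_lower_bound FP r0 rT2; rewrite -/c1.
  have -> : (2 - alpha) / (n%:R - p) = 1.
    by rewrite (_ : n%:R - p = 2 - alpha) ?mulfV ?gt_eqF//; lra.
  by rewrite powRr1// ltW.
- move=> r r0 rT.
  have -> : (n%:R / (2 - alpha) - 1) / (n%:R / (2 - alpha)) = p / n%:R.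
    rewrite (_ : p = n%:R - (2 - alpha)); last by lra.
    by field; rewrite !gt_eqF//=; lra.
  by apply: step FP _; lra.
Qed.

End FlatPieceConsequences.

(** * Convex functions vanishing on the boundary *)

Section Geometry.
Context {R : realType} {n : nat}.
Implicit Types (a x y z q w v : 'rV[R]_n) (Omega A : set 'rV[R]_n)
  (u : 'rV[R]_n -> R).

Lemma convex_setP Omega x y k : convex_set Omega -> Omega x -> Omega y ->
  0 <= k <= 1 -> Omega ((1 - k) *: x + k *: y).
Proof.
move=> cO Ox Oy /andP[k0 k1].
have := cO y x (Itv01 k0 k1) (mem_set Oy) (mem_set Ox).
by rewrite inE addrC.
Qed.

Lemma convex_functionP Omega u : convex_function Omega u -> convex_on Omega u.
Proof.
move=> cu x y k Ox Oy /andP[k0 k1].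
have H : u (k *: y + (1 - k) *: x) <= k * u y + (1 - k) * u x :=
  cu (Itv01 k0 k1) y x (mem_set Oy) (mem_set Ox).
by rewrite addrC [leRHS]addrC.
Qed.

Lemma ball_coord x e y : 0 < e ->
  (forall j, (`|x ord0 j - y ord0 j| : R) < e) -> ball x e y.
Proof. by move=> e0 H; split=> // k j; rewrite ord1; exact: H. Qed.

Lemma coord_le_norm x j : `|x ord0 j| <= `|x|.
Proof.
rewrite [leRHS]/Num.norm /= mx_normrE.
by rewrite (le_trans _ (le_bigmax _ _ (ord0, j))).
Qed.

Lemma closure_ball A x e : closure A x -> 0 < e -> exists2 y, A y & ball x e y.
Proof.
move=> cA e0; have [y [Ay xy]] := cA _ (nbhsx_ballx x e e0).
by exists y.
Qed.

Lemma bounded_closure A : bounded_set A ->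
  exists2 M : R, 0 < M & forall x, closure A x -> `|x| <= M.
Proof.
move=> [M [_ AM]]; exists (Num.max M 0 + 2).
  by rewrite ltr_wpDl// le_max lexx orbT.
move=> x /closure_ball/(_ (@ltr01 R)) [y Ay].
rewrite -ball_normE /= => xy.
have := AM (Num.max M 0 + 1) _ y Ay.
have -> : M < Num.max M 0 + 1 by rewrite ltr_pwDr// le_max lexx.
move=> /(_ isT) yM; rewrite -(subrK y x).
apply: (le_trans (ler_normD _ _)).
rewrite (_ : _ + 2 = 1 + (Num.max M 0 + 1)); last by ring.
by rewrite lerD// ltW.
Qed.

(** Replace [y] by a nearby point of [Omega] and move [w] slightly, within
    [Omega], so that the combination is unchanged. *)
Lemma convex_closure_open Omega y w k :
  open Omega -> convex_set Omega -> closure Omega y -> Omega w -> 0 < k <= 1 ->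
  Omega ((1 - k) *: y + k *: w).
Proof.
move=> oO cO cy Ow /andP[k0 k1].
have /nbhs_ballP[e /= e0 wO] : nbhs w Omega by exact: open_nbhs_nbhs.
have [y' Oy'] := closure_ball cy (mulr_gt0 e0 k0).
move=> [_ yy'].
pose w' := w + ((1 - k) / k) *: (y - y').
have Ow' : Omega w'.
  apply: wO; apply: ball_coord => // j.
  have := yy' ord0 j; rewrite /ball /= => H.
  rewrite coord_line !mxE (_ : _ - _ = - ((1 - k) / k *
    (y ord0 j - y' ord0 j))); last by ring.
  have kk : 0 <= (1 - k) / k by rewrite divr_ge0; lra.
  rewrite normrN normrM (ger0_norm kk).
  apply: (@le_lt_trans _ _ (k^-1 * `|y ord0 j - y' ord0 j|)).
    by rewrite ler_wpM2r// ler_piMl ?invr_ge0 ?ltW//; lra.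
  by rewrite mulrC ltr_pdivrMr.
have -> : (1 - k) *: y + k *: w = (1 - k) *: y' + k *: w'.
  by apply/rowP => j; rewrite !mxE; field; rewrite gt_eqF.
by apply: convex_setP => //; rewrite (ltW k0).
Qed.

(** If [u x > 0], add a small multiple of the square of a coordinate: the
    maximum over the closure cannot be attained at an interior point, by strict
    convexity in that coordinate, nor on the boundary, where the function is
    too small. *)
Lemma convex_nonpositive Omega u : (0 < n)%N ->
  open Omega -> bounded_set Omega ->
  {within closure Omega, continuous u} -> convex_on Omega u ->
  (forall x, boundary Omega x -> u x = 0) -> forall x, Omega x -> u x <= 0.
Proof.
move=> n0 oO bO cu ucvx u0 x Ox; rewrite leNgt; apply/negP => ux.
pose i := Ordinal n0.
have [M M0 HM] := bounded_closure bO.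
pose e := u x / (M ^+ 2 + 1).
have MM : 0 < M ^+ 2 + 1 by rewrite ltr_wpDl// sqr_ge0.
have e0 : 0 < e by rewrite divr_gt0.
pose f z := u z + e * (z ord0 i * z ord0 i).
have cf : {within closure Omega, continuous f}.
  move=> z; apply: cvgD; first exact: cu.
  have cc : continuous (fun z : 'rV[R]_n => e * (z ord0 i * z ord0 i)).
    move=> t; have /= ci := @coord_continuous R 1 n ord0 i t.
    exact: (cvgM (cvg_cst _) (cvgM ci ci)).
  exact: (continuous_subspaceT cc).
have cO : compact (closure Omega).
  apply: bounded_closed_compact; last exact: closed_closure.
  exists M; split; first exact: num_real.
  by move=> t Mt z /HM/le_trans; apply; exact: ltW.
have clx : closure Omega x by exact: subset_closure.
have [c /set_mem cc fmax] := EVT_max_rV (ex_intro _ x clx) cO cf.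
have fx : u x <= f c.
  apply: le_trans (fmax _ (mem_set clx)).
  by rewrite lerDl mulr_ge0 ?(ltW e0)// -expr2 sqr_ge0.
have [ic|nic] := pselect (interior Omega c); last first.
  have uc : u c = 0 by apply: u0.
  move: fx; rewrite /f uc add0r; apply/negP; rewrite -ltNge.
  have c2 : c ord0 i * c ord0 i <= M ^+ 2.
    rewrite -expr2 -real_normK ?num_real// lerXn2r ?nnegrE ?(ltW M0)//.
    exact: le_trans (coord_le_norm _ _) (HM _ cc).
  apply: (@le_lt_trans _ _ (e * M ^+ 2)); first by rewrite ler_wpM2l// ltW.
  by rewrite /e mulrAC ltr_pdivrMr// ltr_pM2l//; lra.
have /nbhs_ballP[h /= h0 cO'] : nbhs c Omega by exact: ic.
have Os s : `|s| < h -> Omega (c + s *: delta_mx 0 i).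
  move=> sh; apply: cO'; apply: ball_coord => // j.
  rewrite coord_line mxE eqxx /= opprD addNKr normrN normrM.
  apply: le_lt_trans sh; rewrite ler_piMr//.
  by case: eqP; rewrite ?normr1 ?normr0.
have h2 : (`|h / 2| : R) < h by rewrite ger0_norm; lra.
have h2' : (`|- (h / 2)| : R) < h by rewrite normrN.
have Op := Os _ h2; have Om := Os _ h2'.
have fp := fmax _ (mem_set (@subset_closure _ Omega _ Op)).
have fm := fmax _ (mem_set (@subset_closure _ Omega _ Om)).
have := ucvx _ _ 2^-1 Op Om.
have -> : 0 <= (2^-1 : R) <= 1 by lra.
have -> : (1 - 2^-1) *: (c + (h / 2) *: delta_mx 0 i) +
    2^-1 *: (c + - (h / 2) *: delta_mx 0 i) = c.
  by apply/rowP => j; rewrite !mxE; field.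
move=> /(_ isT) H; move: fp fm; rewrite /f !coord_line !mxE !eqxx /= mulr1.
have h20 : 0 < h / 2 by lra.
have := mulr_gt0 e0 (mulr_gt0 h20 h20).
lra.
Qed.

(** Extend the segment from a point where [u] is negative to [x] slightly beyond
    [x]. *)
Lemma convex_negative Omega u : open Omega -> convex_on Omega u ->
  (forall x, Omega x -> u x <= 0) -> (exists2 x, Omega x & u x != 0) ->
  forall x, Omega x -> u x < 0.
Proof.
move=> oO ucvx u0 [w Ow uw] x Ox.
have {}uw : u w < 0 by rewrite lt_neqAle uw u0.
have /nbhs_ballP[e /= e0 xO] : nbhs x Omega by exact: open_nbhs_nbhs.
pose d := `|x - w| + 1.
have d0 : 0 < d by rewrite ltr_wpDl.
pose k := e / d.
have k0 : 0 < k by rewrite divr_gt0.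
have Oq : Omega (x + k *: (x - w)).
  apply: xO; apply: ball_coord => // j.
  rewrite coord_line opprD addNKr normrN normrM gtr0_norm// /k mulrAC.
  rewrite ltr_pdivrMr// ltr_pM2l//.
  by apply: le_lt_trans (coord_le_norm _ _) _; rewrite /d; lra.
have k1 : 0 < 1 + k by lra.
have := ucvx _ _ ((1 + k)^-1) Ow Oq.
have -> : (1 - (1 + k)^-1) *: w + (1 + k)^-1 *: (x + k *: (x - w)) = x.
  by apply/rowP => j; rewrite !mxE; field; rewrite gt_eqF.
have ik : 0 <= (1 + k)^-1 < 1 by rewrite invr_ge0 ltW//= invf_lt1//; lra.
have -> : 0 <= (1 + k)^-1 <= 1 by case/andP: ik => -> /ltW.
move=> /(_ isT)/le_lt_trans; apply.
have : (1 - (1 + k)^-1) * u w < 0 by rewrite pmulr_rlt0//; lra.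
have : (1 + k)^-1 * u (x + k *: (x - w)) <= 0.
  by rewrite mulr_ge0_le0 ?u0//; lra.
lra.
Qed.

End Geometry.

(** * The domain near a flat piece of its boundary *)

Section FlatBoundaryGeometry.
Context {R : realType} {n : nat}.
Implicit Types (a x y z q w v : 'rV[R]_n) (Omega A Gamma K : set 'rV[R]_n).

(** This norm is controlled coordinate by coordinate, dominates [enorm], and has
    an immediate triangle inequality. *)
Definition norm1 v : R := \sum_(j < n) `|v ord0 j|.

Lemma norm1D v w : norm1 (v + w) <= norm1 v + norm1 w.
Proof.
by rewrite -big_split; apply: ler_sum => j _; rewrite mxE ler_normD.
Qed.

Lemma norm1Z k v : norm1 (k *: v) = `|k| * norm1 v.
Proof. by rewrite mulr_sumr; apply: eq_bigr => j _; rewrite mxE normrM. Qed.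

Lemma norm1_ge0 v : 0 <= norm1 v. Proof. exact: sumr_ge0. Qed.

Lemma normr_dot_le a v r :
  (forall j, (`|v ord0 j| : R) <= r) -> `|dot a v| <= norm1 a * r.
Proof.
move=> vr; apply: (le_trans (ler_norm_sum _ _ _)); rewrite mulr_suml.
by apply: ler_sum => j _; rewrite normrM ler_wpM2l.
Qed.

Lemma coord_le_enorm v j : `|v ord0 j| <= enorm v.
Proof.
rewrite -sqrtr_sqr ler_sqrt; last first.
  by apply: sumr_ge0 => k _; rewrite -expr2 sqr_ge0.
rewrite /dot expr2; apply: (@ler_sum_term _ _ (fun k => v ord0 k * v ord0 k)).
by move=> k; rewrite -expr2 sqr_ge0.
Qed.

Lemma enorm_le_norm1 v : enorm v <= norm1 v.
Proof.
rewrite -(ger0_norm (norm1_ge0 v)) -sqrtr_sqr; apply: ler_wsqrtr.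
rewrite expr2 {1}/norm1 mulr_suml; apply: ler_sum => j _.
apply: le_trans (ler_norm _) _; rewrite normrM ler_wpM2l//.
exact: (@ler_sum_term _ _ (fun k => `|v ord0 k|)).
Qed.

Lemma enorm_vertical i a s : `|a ord0 i| = 1 ->
  enorm (s *: vertical i a) = `|s|.
Proof.
move=> /normr1_sqr ai; rewrite /enorm dotZr dot_vertical.
rewrite -sqrtr_sqr /vertical !mxE !eqxx /= mulr1; congr Num.sqrt.
by rewrite [s * a _ _]mulrC [a _ _ * (_ * s)]mulrA ai mul1r expr2.
Qed.

Lemma dist_le x y A : A y -> dist x A <= enorm (x - y).
Proof.
move=> Ay; apply: ge_inf; last by exists y.
by exists 0 => _ [z _ <-]; exact: sqrtr_ge0.
Qed.

Lemma le_dist x A r : A !=set0 -> (forall y, A y -> r <= enorm (x - y)) ->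
  r <= dist x A.
Proof.
move=> [y Ay] H; apply: lb_le_inf; first by exists (enorm (x - y)); exists y.
by move=> _ [z Az <-]; exact: H.
Qed.

Lemma dist_lt x A r : A !=set0 -> dist x A < r ->
  exists2 y, A y & enorm (x - y) < r.
Proof.
move=> [y Ay] xr; apply: contrapT => H.
have : r <= dist x A.
  apply: le_dist; first by exists y.
  by move=> z Az; rewrite leNgt; apply/negP => zr; apply: H; exists z.
by rewrite leNgt xr.
Qed.

Lemma boundary_open Omega x : open Omega -> boundary Omega x -> ~ Omega x.
Proof. by move=> oO [_ nx] Ox; apply: nx; exact: open_nbhs_nbhs. Qed.

Lemma dist_boundary_gt0 Omega x : open Omega -> boundary Omega !=set0 ->
  Omega x -> 0 < dist x (boundary Omega).
Proof.
move=> oO b0 Ox.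
have /nbhs_ballP[e /= e0 xO] : nbhs x Omega by exact: open_nbhs_nbhs.
apply: lt_le_trans e0 _; apply: le_dist => // y by_.
rewrite leNgt; apply/negP => ye; apply: (boundary_open oO by_); apply: xO.
apply: ball_coord => [|j]; first by apply: le_lt_trans ye; exact: sqrtr_ge0.
apply: le_lt_trans ye; apply: le_trans (coord_le_enorm _ j).
by rewrite !mxE.
Qed.

(** Points near [z] inherit half of the radius available at [z]; compactness
    then makes the radius uniform. *)
Lemma uniform_radius (H K Gamma : set 'rV[R]_n) : compact K ->
  K `<=` relative_interior H Gamma ->
  exists2 r : R, 0 < r & forall z y, K z -> H y -> norm1 (y - z) < r -> Gamma y.
Proof.
move=> /compact_near_coveringP cK KG.
pose P (r : R) z := forall y, H y -> norm1 (y - z) < r -> Gamma y.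
have KP : \forall r \near 0^'+, K `<=` P r.
  apply: cK => z Kz; have [_ [r r0 zr]] := KG _ Kz.
  have n0 : 0 < n%:R + 1 :> R by rewrite ltr_wpDl.
  have e0 : 0 < r / 2 / (n%:R + 1) by rewrite !divr_gt0.
  exists (ball z (r / 2 / (n%:R + 1)), [set s | s < r / 2]) => /=.
    split; first exact: nbhsx_ballx.
    by apply: nbhs_right_lt; lra.
  move=> [z' s] /= [[_ zz'] sr] y Hy ys; apply: zr => //.
  apply: le_lt_trans (enorm_le_norm1 _) _.
  rewrite -(subrKA z') (le_lt_trans (norm1D _ _))//.
  have : norm1 (z' - z) <= n%:R * (r / 2 / (n%:R + 1)).
    move: zz'; set e := r / 2 / _ => zz'.
    rewrite -[n in n%:R]card_ord mulr_natl -sumr_const; apply: ler_sum => j _.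
    have := zz' ord0 j; rewrite /ball /= => H'.
    by rewrite !mxE distrC ltW.
  have : n%:R * (r / 2 / (n%:R + 1)) <= r / 2.
    by rewrite mulrCA ler_piMr ?divr_ge0 ?(ltW r0)// ler_pdivrMr// mul1r lerDl.
  lra.
near (0 : R)^'+ => r.
exists r => // z y Kz; have : K `<=` P r by near: r.
by move=> /(_ _ Kz); apply.
Unshelve. all: by end_near. Qed.

(** If [Omega] had a point [x] in the hyperplane, the segment from [x] to [z]
    could be extended beyond [z] inside the closure of [Omega], so that [z]
    would be interior. Hence [Omega] lies strictly on one side, and the equation
    can be rescaled so as to be positive there, with a coefficient of modulus
    [1]. *)
Lemma supporting_hyperplane Omega a b z r : open Omega -> convex_set Omega ->
  Omega !=set0 -> a != 0 -> boundary Omega z -> hyperplane a b z -> 0 < r ->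
  (forall y, hyperplane a b y -> norm1 (y - z) < r -> closure Omega y) ->
  exists i (a' : 'rV[R]_n) b', [/\ `|a' ord0 i| = 1,
    forall x, hyperplane a b x <-> ell a' b' x = 0 &
    forall x, Omega x -> 0 < ell a' b' x].
Proof.
move=> oO cO [w Ow] /rV0Pn[i ai] bz hz r0 Hr.
have disj x : Omega x -> ell a b x != 0.
  move=> Ox; apply/eqP => lx; apply: (boundary_open oO bz).
  pose k := r / (norm1 (z - x) + 1).
  have N0 : 0 < norm1 (z - x) + 1 by rewrite ltr_wpDl ?norm1_ge0.
  have k0 : 0 < k by rewrite divr_gt0.
  have hq : hyperplane a b (z + k *: (z - x)).
    move: lx hz; rewrite /ell /hyperplane /= dotDr dotZr dotBr => /eqP.
    by rewrite subr_eq0 => /eqP -> ->; rewrite subrr mulr0 addr0.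
  have cq : closure Omega (z + k *: (z - x)).
    apply: Hr => //; rewrite addrAC subrr add0r norm1Z gtr0_norm// /k mulrAC.
    by rewrite ltr_pdivrMr// ltr_pM2l// ltrDl.
  have k1 : 0 < 1 + k by lra.
  have kk : 0 < k / (1 + k) <= 1 by rewrite divr_gt0//= ler_pdivrMr//; lra.
  have := convex_closure_open oO cO cq Ox kk.
  congr (Omega _); apply/rowP => j; rewrite !mxE; field.
  by rewrite gt_eqF.
have ai0 : 0 < `|a ord0 i| by rewrite normr_gt0.
pose c := Num.sg (ell a b w) / `|a ord0 i|.
have c0 : c != 0.
  by rewrite mulf_neq0 ?invr_neq0 ?(gt_eqF ai0)// sgr_eq0 disj.
have ellc x : ell (c *: a) (c * b) x = c * ell a b x.
  rewrite /ell mulrBr; congr (_ - _); rewrite mulr_sumr.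
  by apply: eq_bigr => j _; rewrite mxE mulrA.
exists i, (c *: a), (c * b); split.
- rewrite mxE normrM /c normrM normr_sg disj// mul1r normfV normr_id.
  by rewrite mulVf// gt_eqF.
- move=> x; rewrite ellc /hyperplane /ell /=; split => [->|].
    by rewrite subrr mulr0.
  by move=> /eqP; rewrite mulf_eq0 (negPf c0) subr_eq0 => /eqP.
move=> x Ox; rewrite ellc /c mulrAC divr_gt0//.
rewrite ltNge; apply/negP => sx.
have lw := disj _ Ow.
pose lo := `|ell a b w|; have lo0 : 0 < lo by rewrite normr_gt0.
pose lx := Num.sg (ell a b w) * ell a b x.
have dd : 0 < lo - lx by rewrite /lx; lra.
have kk : 0 <= lo / (lo - lx) <= 1.
  rewrite (divr_ge0 (ltW lo0) (ltW dd)) ler_pdivrMr// mul1r.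
  by rewrite lerDl oppr_ge0.
have := disj _ (convex_setP cO Ow Ox kk); rewrite ell_conv => /eqP; apply.
have s2 : Num.sg (ell a b w) * Num.sg (ell a b w) = 1.
  by rewrite -expr2 sqr_sg lw.
have -> : ell a b x = Num.sg (ell a b w) * lx by rewrite mulrA s2 mul1r.
have {1}-> : ell a b w = Num.sg (ell a b w) * lo by rewrite -numEsg.
by field; rewrite gt_eqF.
Qed.

Lemma slab_norm1 i a b x z rho t : `|a ord0 i| = 1 -> ell a b z = 0 ->
  (forall j, j != i -> (`|x ord0 j - z ord0 j| : R) <= rho) ->
  0 <= ell a b x <= t -> 0 <= rho ->
  norm1 (x - z) <= (n%:R + norm1 a) * rho + t.
Proof.
move=> ai lz xz /andP[x0 xt] rho0.
have H1 : \sum_(j < n | j != i) `|(x - z) ord0 j| <= n%:R * rho.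
  apply: (@le_trans _ _ (\sum_(j < n | j != i) rho)).
    by apply: ler_sum => j ji; rewrite !mxE xz.
  rewrite sumr_const -[_ *+ _]mulr_natl ler_wpM2r// ler_nat.
  by apply: leq_trans (max_card _) _; rewrite card_ord.
have H2 : `|(x - z) ord0 i| <= norm1 a * rho + t.
  have E : a ord0 i * (x - z) ord0 i =
      ell a b x - \sum_(j < n | j != i) a ord0 j * (x - z) ord0 j.
    have : dot a (x - z) = ell a b x.
      by rewrite -[RHS]subr0 -lz /ell dotBr; ring.
    by rewrite /dot (bigD1 i)//= => <-; rewrite addrK.
  have -> : `|(x - z) ord0 i| = `|a ord0 i * (x - z) ord0 i|.
    by rewrite normrM ai mul1r.
  rewrite E; apply: (le_trans (ler_normB _ _)).
  rewrite [leLHS]addrC; apply: lerD; last by rewrite ger0_norm.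
  apply: (le_trans (ler_norm_sum _ _ _)).
  apply: (@le_trans _ _ (\sum_(j < n | j != i) `|a ord0 j| * rho)).
    by apply: ler_sum => j ji; rewrite normrM ler_wpM2l// !mxE xz.
  rewrite -mulr_suml ler_wpM2r// /norm1 [leRHS](bigD1 i)//= lerDr//.
rewrite [norm1 (x - z)](bigD1 i)//= mulrDl.
apply: le_trans (lerD H2 H1) _.
by rewrite le_eqVlt; apply/orP; left; apply/eqP; ring.
Qed.

(** Let [w] be a point of [Omega] at height [L]. A point [x] at height
    [lam * L], with [lam] small, is the combination [(1 - lam) *: y + lam *: w]
    of [w] and a point [y] of the hyperplane close to [z]; that [y] belongs to
    the boundary, so [x] is in [Omega]. The vertical projection of [x] on the
    hyperplane also lies in the boundary, which bounds the distance of [x] to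
    the boundary. *)
Lemma slab_in_domain Omega K i a b r : open Omega -> convex_set Omega ->
  bounded_set Omega -> Omega !=set0 ->
  `|a ord0 i| = 1 -> (forall x, Omega x -> 0 < ell a b x) -> 0 < r ->
  K `<=` closure Omega -> (forall z, K z -> ell a b z = 0) ->
  (forall z y, K z -> ell a b y = 0 -> norm1 (y - z) < r ->
     boundary Omega y) ->
  exists rho T : R, [/\ 0 < rho, 0 < T & forall z x, K z ->
    slab i a b z rho 0 T x ->
    Omega x /\ dist x (boundary Omega) <= ell a b x].
Proof.
move=> oO cO bO [w Ow] ai pos r0 Kcl Kl Kr.
have ai2 := normr1_sqr ai.
pose L := ell a b w; have L0 : 0 < L := pos _ Ow.
have [M M0 HM] := bounded_closure bO.
pose D := n%:R * (2 * M).
have D0 : 0 <= D by rewrite !mulr_ge0// ltW.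
have KD z : K z -> norm1 (w - z) <= D.
  move=> Kz; rewrite /D -[n in n%:R]card_ord mulr_natl -sumr_const.
  apply: ler_sum => j _; rewrite !mxE; apply: (le_trans (ler_normB _ _)).
  rewrite [leRHS](_ : _ = M + M); last by ring.
  apply: lerD; apply: le_trans (coord_le_norm _ _) _; apply: HM.
    exact: subset_closure.
  exact: Kcl.
pose S := n%:R + norm1 a.
have S0 : 0 <= S by rewrite addr_ge0 ?norm1_ge0.
pose rho := r / (8 * (S + 1)).
have rho0 : 0 < rho by rewrite divr_gt0// mulr_gt0// ltr_wpDl.
have Srho : S * rho <= r / 8.
  rewrite /rho mulrCA ler_pM2l// ler_pdivrMr ?mulr_gt0 ?ltr_wpDl//.
  lra.
pose T := Num.min (L / 2) (r / (8 * (1 + D / L))).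
have DL : 0 <= D / L by rewrite divr_ge0// ltW.
have T0 : 0 < T.
  by rewrite lt_min divr_gt0//= divr_gt0// mulr_gt0// ltr_pwDl.
have TL : T <= L / 2 by rewrite ge_min lexx.
have Tr : T * (1 + D / L) <= r / 8.
  have D1 : 0 < 1 + D / L by rewrite ltr_pwDl.
  have : T <= r / (8 * (1 + D / L)) by rewrite ge_min lexx orbT.
  move=> H; apply: le_trans (ler_wpM2r (ltW D1) H) _.
  by rewrite invfM mulrA divfK// lt0r_neq0.
exists rho, T; split=> // z x Kz [xj /andP[x0 xT]].
have xj' j : j != i -> (`|x ord0 j - z ord0 j| : R) <= rho.
  by move=> ji; apply: ltW; exact: xj.
have lz := Kl _ Kz.
pose lam := ell a b x / L.
have lam0 : 0 < lam by rewrite divr_gt0.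
have lam2 : lam <= 1 / 2 by rewrite ler_pdivrMr//; lra.
have l1 : 0 < 1 - lam by lra.
split.
  pose y := (1 - lam)^-1 *: (x - lam *: w).
  have xE : x = (1 - lam) *: y + lam *: w.
    by rewrite scalerA mulfV ?gt_eqF// scale1r subrK.
  have ly : ell a b y = 0.
    have := ell_conv a b y w lam; rewrite -xE -/L /lam divfK ?gt_eqF// => H.
    have : (1 - lam) * ell a b y = 0 by rewrite /lam; lra.
    by move=> /eqP; rewrite mulf_eq0 (gt_eqF l1) => /eqP.
  have yz : norm1 (y - z) < r.
    have -> : y - z = (1 - lam)^-1 *: ((x - z) + (- lam) *: (w - z)).
      by apply/rowP => j; rewrite !mxE; field; rewrite gt_eqF.
    rewrite norm1Z normfV gtr0_norm// mulrC ltr_pdivrMr//.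
    apply: le_lt_trans (norm1D _ _) _; rewrite norm1Z normrN gtr0_norm//.
    have xzn : norm1 (x - z) <= S * rho + T.
      apply: (@slab_norm1 i a b) => //; last exact: ltW.
      by rewrite !ltW.
    have : lam * norm1 (w - z) <= T / L * D.
      apply: ler_pM; rewrite ?(ltW lam0) ?norm1_ge0 ?KD//.
      by rewrite ler_pM2r ?invr_gt0// ltW.
    have : r * (1 / 2) <= r * (1 - lam) by rewrite ler_pM2l//; lra.
    by rewrite mulrAC; lra.
  rewrite xE; apply: convex_closure_open => //; last by lra.
  by case: (Kr _ _ Kz ly yz).
pose y := x + (- ell a b x) *: vertical i a.
have ly : ell a b y = 0 by rewrite ell_line dot_vertical ai2; ring.
have yz : norm1 (y - z) < r.
  have : norm1 (y - z) <= S * rho + 0.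
    apply: (@slab_norm1 i a b) => //; rewrite ?ly ?lexx ?ltW// => j ji.
    by rewrite coord_line vertical_neq// mulr0 addr0 xj'.
  lra.
apply: le_trans (dist_le _ (Kr _ _ Kz ly yz)) _.
have -> : x - y = ell a b x *: vertical i a.
  by rewrite /y scaleNr opprB addrC subrK.
by rewrite enorm_vertical// ger0_norm// ltW.
Qed.

End FlatBoundaryGeometry.

(** * From the flat piece to the distance function *)

Section NearFlatPiece.
Context {R : realType} {n : nat}.
Implicit Types (a x y z : 'rV[R]_n) (Omega K : set 'rV[R]_n).

Lemma slab_center i a b x z rho t y : (forall j, j != i ->
    (`|x ord0 j - z ord0 j| : R) < rho) ->
  (forall j, j != i -> y ord0 j = x ord0 j) ->
  slab i a b y rho 0 t `<=` slab i a b z (2 * rho) 0 t.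
Proof.
move=> xz yx w [wj wt]; split=> // j ji.
have -> : w ord0 j - z ord0 j = (w ord0 j - y ord0 j) + (x ord0 j - z ord0 j).
  by rewrite yx//; ring.
apply: le_lt_trans (ler_normD _ _) _; rewrite mulr2n mulrDl mul1r.
by apply: ltrD; [exact: wj|exact: xz].
Qed.

(** A point closer to [y + s *: vertical i a] than this bound has height between
    [s / 2] and [3 * s / 2], hence lies in the slab and not on the boundary. *)
Lemma le_dist_boundary Omega i a b y rho T s : open Omega ->
  boundary Omega !=set0 -> ell a b y = 0 ->
  `|a ord0 i| = 1 -> slab i a b y rho 0 T `<=` Omega ->
  0 < s -> s <= rho -> 2 * s <= T ->
  (2 * norm1 a)^-1 * s <= dist (y + s *: vertical i a) (boundary Omega).
Proof.
move=> oO b0 ly ai sub s0 sr sT.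
have a1 : 1 <= norm1 a.
  by rewrite -[leLHS]ai; exact: (@ler_sum_term _ _ (fun j => `|a ord0 j|)).
apply: le_dist => // w bw; rewrite leNgt; apply/negP => lt.
apply: (boundary_open oO bw); apply: sub.
set x := y + _ in lt.
have a0 : 0 < norm1 a by lra.
have A2 : 0 < 2 * norm1 a by lra.
have av : dot a (vertical i a) = 1 by rewrite dot_vertical normr1_sqr.
have lx : ell a b x = s by rewrite ell_line ly av; ring.
have cs : (2 * norm1 a)^-1 * s < s.
  by rewrite gtr_pMl// invf_lt1//; lra.
have lw : ell a b w = s - dot a (x - w) by rewrite -lx /ell dotBr; ring.
have dw : `|dot a (x - w)| <= s / 2.
  have -> : s / 2 = norm1 a * ((2 * norm1 a)^-1 * s).
    by field; rewrite gt_eqF.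
  by apply: normr_dot_le => j; apply: le_trans (coord_le_enorm _ j) (ltW lt).
split=> [j ji|]; last by move: dw; rewrite ler_norml lw; lra.
have -> : w ord0 j - y ord0 j = - (x - w) ord0 j.
  by rewrite /x -[- w]scaleN1r !coord_line vertical_neq//; ring.
rewrite normrN; apply: le_lt_trans (coord_le_enorm _ j) _; lra.
Qed.

(** Both logarithms are comparable to [ln s] for small [s]; the threshold
    [s <= c] gives [ln (c * s) >= 2 * ln s], and [s <= (T / 2) ^+ 2] gives
    [ln (T / 2) >= ln s / 2]. *)
Lemma log_dist_comparison (T c s d : R) : 0 < T -> 0 < c <= 1 ->
  0 < s -> s <= c -> s < 1 -> s <= (T / 2) ^+ 2 -> c * s <= d <= s ->
  `|ln d| <= 4 * ln (T / 2 / s).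
Proof.
move=> T0 /andP[c0 c1] s0 sc s1 sT /andP[cd ds].
have cs0 : 0 < c * s by rewrite mulr_gt0.
have d0 : 0 < d by lra.
have T2 : 0 < T / 2 by lra.
have lns : ln s < 0 by rewrite ln_lt0// s0.
have lnd : ln d < 0 by rewrite ln_lt0// d0; lra.
have H1 : ln c + ln s <= ln d by rewrite -lnM ?posrE// ler_ln ?posrE.
have H2 : ln s <= ln c by rewrite ler_ln ?posrE.
have H3 : ln s <= ln (T / 2) *+ 2 by rewrite -lnXn// ler_ln ?posrE ?exprn_gt0.
have H4 : ln (T / 2 / s) = ln (T / 2) - ln s by rewrite ln_div ?posrE.
rewrite mulr2n in H3; rewrite ltr0_norm// H4; lra.
Qed.

End NearFlatPiece.

Theorem theorem1p7 (R : realType) (n : nat) (hn : (2 <= n)%N)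
  (Omega : set 'rV[R]_n) (hOmega : bounded_convex_domain Omega)
  (alpha p : R) (halpha0 : 0 <= alpha) (halpha2 : alpha < 2) (hp : 0 < p)
  (Gamma : set 'rV[R]_n) (hGclosed : closed Gamma)
  (hGboundary : Gamma `<=` boundary Omega)
  (a : 'rV[R]_n) (b : R) (ha : a != 0)
  (hGplane : Gamma `<=` hyperplane a b)
  (hGball : exists (z : 'rV[R]_n) (r : R), [/\ hyperplane a b z, 0 < r &
     forall y, hyperplane a b y -> enorm (y - z) < r -> Gamma y])
  (Gamma' : set 'rV[R]_n) (hG'compact : compact Gamma') (hG'0 : Gamma' !=set0)
  (hG'int : Gamma' `<=` relative_interior (hyperplane a b) Gamma) :
  exists c delta : R, [/\ 0 < c, 0 < delta &
    forall u : 'rV[R]_n -> R,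
      {within closure Omega, continuous u} ->
      convex_function Omega u ->
      (exists2 x, closure Omega x & u x != 0) ->
      monge_ampere_ge Omega u
        (fun x => `|u x| `^ p * dist x (boundary Omega) `^ (- alpha)) ->
      (forall x, boundary Omega x -> u x = 0) ->
      forall x, Omega x -> dist x Gamma' < delta ->
        (p - alpha < n%:R - 2 ->
           c * dist x (boundary Omega) `^ ((2 - alpha) / (n%:R - p)) <= `|u x|)
        /\
        (p - alpha = n%:R - 2 ->
           c * (dist x (boundary Omega) *
                `|ln (dist x (boundary Omega))| `^ (n%:R / (2 - alpha)))
             <= `|u x|)].
Proof.
case: hOmega => oO O0 cO bO.
have n0 : (0 < n)%N by exact: leq_trans hn.
have n2 : 2 <= n%:R :> R by rewrite ler_nat.
have Gcl : Gamma `<=` closure Omega by move=> x /hGboundary[].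
have G'G : Gamma' `<=` Gamma by move=> x /hG'int[].
have [r r0 Hr] := uniform_radius hG'compact hG'int.
have [z0 Gz0] := hG'0.
have [i [a' [b' [ai hyp pos]]]] : exists i (a' : 'rV[R]_n) b',
    [/\ `|a' ord0 i| = 1, forall x, hyperplane a b x <-> ell a' b' x = 0 &
    forall x, Omega x -> 0 < ell a' b' x].
  apply: (@supporting_hyperplane _ _ Omega a b z0 r) => //.
  - exact/hGboundary/G'G.
  - exact/hGplane/G'G.
  - by move=> y Hy yz; apply: Gcl; exact: Hr Gz0 Hy yz.
have Kl z : Gamma' z -> ell a' b' z = 0 by move=> /G'G/hGplane/hyp.
have [rho [T [rho0 T0 slabO]]] : exists rho T : R, [/\ 0 < rho, 0 < T &
    forall z x, Gamma' z -> slab i a' b' z rho 0 T x ->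
    Omega x /\ dist x (boundary Omega) <= ell a' b' x].
  apply: (@slab_in_domain _ _ Omega Gamma' i a' b' r) => //.
  - by move=> z /G'G/Gcl.
  - by move=> z y Gz /hyp Hy yz; apply: hGboundary; exact: Hr Gz Hy yz.
have b0 : boundary Omega !=set0 by exists z0; exact/hGboundary/G'G.
have al : 0 <= alpha < 2 by rewrite halpha0.
pose rh := rho / 2; have rh0 : 0 < rh by rewrite divr_gt0.
pose A := norm1 a'.
have A1 : 1 <= A.
  by rewrite -[leLHS]ai; exact: (@ler_sum_term _ _ (fun j => `|a' ord0 j|)).
pose c1 := (2 * A)^-1.
have c10 : 0 < c1 by rewrite invr_gt0; lra.
have c11 : c1 < 1 by rewrite invf_lt1; lra.
(* The function ell is A-Lipschitz and vanishes on Gamma', so points at distance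
   less than m / A from Gamma' have height at most m. *)
pose m := Num.min (Num.min rh (T / 2)) (Num.min c1 ((T / 2) ^+ 2)).
have T20 : 0 < T / 2 by lra.
have m0 : 0 < m by rewrite !lt_min rh0 T20 c10 exprn_gt0.
have mE s : s <= m -> [/\ s <= rh, 2 * s <= T, s <= c1 & s <= (T / 2) ^+ 2].
  rewrite !le_min => /andP[/andP[s1 s2] /andP[s3 s4]]; split=> //; lra.
pose delta := m / A.
have d0 : 0 < delta by rewrite divr_gt0//; lra.
have deltam : delta <= m by rewrite ler_pdivrMr ?ler_peMr ?(ltW m0)//; lra.
(* Every x close to Gamma' lies vertically above a point y of the flat piece, at
   a height s comparable to its distance to the boundary. *)
have frame u : {within closure Omega, continuous u} ->
    convex_function Omega u -> (exists2 x, closure Omega x & u x != 0) ->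
    monge_ampere_ge Omega u
      (fun x => `|u x| `^ p * dist x (boundary Omega) `^ (- alpha)) ->
    (forall x, boundary Omega x -> u x = 0) -> p < n%:R ->
    forall x, Omega x -> dist x Gamma' < delta ->
    exists y s, [/\ flat_piece i a' b' Omega alpha p u y rh T, 0 < s <= m,
      `|u x| = depth u i a' y s &
      c1 * s <= dist x (boundary Omega) <= s].
  move=> cu ucvx unz MA u0 pn x Ox /(dist_lt hG'0)[z Gz xz].
  have cvx := convex_functionP ucvx.
  have neg : forall x, Omega x -> u x < 0.
    apply: convex_negative => //; first exact: convex_nonpositive.
    have [w cw uw] := unz; exists w => //; apply: contrapT => nOw.
    move/eqP: uw; apply; apply: u0; split => // iw; apply: nOw.
    exact: interior_subset iw.
  pose s := ell a' b' x; have s0 : 0 < s := pos _ Ox.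
  have sm : s <= m.
    have -> : s = dot a' (x - z).
      by rewrite -[s]subr0 -(Kl _ Gz) /s /ell dotBr; ring.
    apply: le_trans (ler_norm _) _.
    have -> : m = A * delta by rewrite mulrC divfK// gt_eqF//; lra.
    by apply: normr_dot_le => j; apply: le_trans (coord_le_enorm _ j) (ltW xz).
  have [s1 s2 s3 s4] := mE _ sm.
  pose y := x + (- s) *: vertical i a'.
  have ai2 := normr1_sqr ai.
  have xE : x = y + s *: vertical i a' by rewrite /y scaleNr subrK.
  have ly : ell a' b' y = 0 by rewrite ell_line dot_vertical ai2 /s; ring.
  have yx j : j != i -> y ord0 j = x ord0 j.
    by move=> ji; rewrite coord_line vertical_neq// mulr0 addr0.
  have xzj j : j != i -> (`|x ord0 j - z ord0 j| : R) < rh.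
    move=> _; have := coord_le_enorm (x - z) j.
    rewrite !mxE => /le_lt_trans; apply.
    by apply: lt_le_trans xz (le_trans deltam _); rewrite !ge_min lexx.
  have sub w : slab i a' b' y rh 0 T w ->
      Omega w /\ dist w (boundary Omega) <= ell a' b' w.
    move=> /(slab_center xzj yx); rewrite (_ : 2 * rh = rho); last first.
      by rewrite /rh mulrC divfK.
    exact: slabO.
  have Oy : slab i a' b' y rh 0 T `<=` Omega by move=> w /sub[].
  exists y, s; split.
  - split => //; first by rewrite hp.
    by move=> w ws; have [Ow ->] := sub w ws; rewrite dist_boundary_gt0.
  - by rewrite s0.
  - by rewrite /depth -xE ltr0_norm ?neg.
  - apply/andP; split; last first.
      apply: (proj2 (sub _ _)); split=> [j ji|]; last by rewrite -/s; lra.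
      by rewrite yx// subrr normr0.
    by rewrite [in leRHS]xE; apply: le_dist_boundary Oy _ _ _.
have [lt|ge] := ltP (p - alpha) (n%:R - 2).
  have pn : p < n%:R by lra.
  exists ((2 `^ p * @mass_constant R n rh) `^ (- (n%:R - p)^-1)), delta.
  split=> //.
    by apply/powR_gt0/mulr_gt0; [exact: powR_gt0|exact: mass_constant_gt0].
  move=> u cu ucvx unz MA u0 x Ox xd; split=> [_|]; last by lra.
  have [y [s [FP /andP[s0 sm] -> /andP[cd ds]]]] :=
    frame u cu ucvx unz MA u0 pn x Ox xd.
  have [_ s2 _ _] := mE _ sm.
  apply: le_trans (depth_lower_bound FP s0 s2).
  rewrite ler_wpM2l ?powR_ge0//; apply: ge0_ler_powR; rewrite ?nnegrE//.
  - by rewrite divr_ge0// ltW// subr_gt0.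
  - by apply: le_trans cd; rewrite mulr_ge0 ?ltW.
  - exact: ltW.
have [pal|npal] := eqVneq (p - alpha) (n%:R - 2); last first.
  exists 1, delta; split=> // u _ _ _ _ _ x _ _; split; first by lra.
  by move=> E; rewrite E eqxx in npal.
have pn : p < n%:R by lra.
have [eta e0 H] := depth_log_lower_bound hn T0 rh0 al hp pal.
have k0 : 0 <= n%:R / (2 - alpha).
  by rewrite divr_ge0// ltW// subr_gt0.
have e4 : 0 < eta / 4 by rewrite divr_gt0.
exists ((eta / 4) `^ (n%:R / (2 - alpha))), delta.
split=> //; first exact: powR_gt0.
move=> u cu ucvx unz MA u0 x Ox xd; split=> [|_]; first by lra.
have [y [s [FP /andP[s0 sm] -> /andP[cd ds]]]] :=
  frame u cu ucvx unz MA u0 pn x Ox xd.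
have [_ s2 s3 s4] := mE _ sm.
set d := dist _ _ in cd ds *.
have dge0 : 0 <= d by apply: le_trans cd; rewrite mulr_ge0 ?ltW.
have lnd : `|ln d| <= 4 * ln (T / 2 / s).
  apply: (log_dist_comparison T0 _ s0 s3 _ s4); rewrite ?c10 ?cd ?(ltW c11)//.
  exact: le_lt_trans s3 c11.
have := H _ _ _ _ _ _ _ FP s0 s2; rewrite ler_pdivlMr// => /(le_trans _); apply.
rewrite mulrCA [leRHS]mulrC; apply: ler_pM => //.
  by rewrite mulr_ge0 ?powR_ge0.
rewrite -powRM ?normr_ge0 ?(ltW e4)//.
have el : eta / 4 * `|ln d| <= eta * ln (T / 2 / s).
  by rewrite -mulrA (ler_wpM2l (ltW e0))// ler_pdivrMl.
apply: ge0_ler_powR; rewrite ?nnegrE//.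
  by rewrite mulr_ge0 ?(ltW e4).
by apply: le_trans el; rewrite mulr_ge0 ?(ltW e4).
Qed.
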